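(* There is no bicyclic graph $G$ with maximum degree $\Delta(G)\leq 3$ such that $E(G)=n$, where $n$ is the number of vertices of $G$.
   Context: A bicyclic graph is a connected simple graph with cyclomatic number $m-n+1=2$ ($m$ the number of edges, $n$ the number of vertices). For a simple graph $G$ with adjacency eigenvalues $\lambda_1,\dots,\lambda_n$, the energy is $E(G)=\sum_{i=1}^n|\lambda_i|$. *)

(* Defs.v *)
From HB Require Import structures.
From mathcomp Require Import all_boot all_order all_algebra all_field.

Set Implicit Arguments.
Unset Strict Implicit.
Unset Printing Implicit Defensive.

Import Order.TTheory GRing.Theory Num.Theory.
Local Open Scope ring_scope.

Record sgraph := SGraph {
  vertex :> finType;
  adj : rel vertex;
  adj_sym : symmetric adj;
  adj_irrefl : irreflexive adj }.

Definition edges (G : sgraph) : {set {set G}} :=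
  [set [set p.1; p.2] | p : G * G & adj p.1 p.2].

Definition degree (G : sgraph) (x : G) : nat := #|[set y | adj x y]|.

Definition max_degree (G : sgraph) : nat := \max_(x : G) degree x.

Definition connected (G : sgraph) : Prop :=
  (0 < #|G|)%N /\ forall x y : G, connect (@adj G) x y.

(* Integer-valued, so that the subtraction is not truncated. *)
Definition cyclomatic (G : sgraph) : int := #|edges G|%:Z - #|G|%:Z + 1.

Definition bicyclic (G : sgraph) : Prop := connected G /\ cyclomatic G = 2.

Definition adjmx (G : sgraph) : 'M[algC]_#|G| :=
  \matrix_(i, j) (adj (enum_val i) (enum_val j))%:R.

(* Eigenvalues are repeated according to their algebraic multiplicity, which
   for the symmetric matrix [adjmx G] is also the geometric one. *)
Definition eigenvalues n (A : 'M[algC]_n) : seq algC :=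
  sval (closed_field_poly_normal (char_poly A)).

Lemma char_poly_eigenvalues n (A : 'M[algC]_n) :
  char_poly A = \prod_(x <- eigenvalues A) ('X - x%:P).
Proof.
rewrite /eigenvalues; case: closed_field_poly_normal => s /= {1}->.
by rewrite (monicP (char_poly_monic A)) scale1r.
Qed.

Definition energy (G : sgraph) : algC := \sum_(x <- eigenvalues (adjmx G)) `|x|.

(* Main.v *)
(** The energy is the trace of [|A|], and [|y| >= 3 y^2 / (2 t) - y^4 / (2 t^3)]
    for every [t > 0], so each diagonal entry of [|A|] is bounded below by the
    numbers of closed 2- and 4-walks at its vertex, with a scale [t] that may
    depend on the vertex.  A closed 4-walk count is [d^2 - d], plus the sum of
    the degrees of the neighbours, plus twice the number of 4-cycles at the
    vertex.  Since the numbers [d - 2] add up to [2], a discharging argument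
    shows that the local bounds add up to more than [n] unless there are three
    4-cycles; as the cycle space has dimension 2, three 4-cycles form a
    [K_{2,3}].  In that case the part of three vertices is handled as a whole, by
    evaluating the quadratic form of [|A|] in another orthogonal basis of its
    span; only [K_{2,3}] itself escapes, and its energy [2 sqrt 6] is less
    than [5]. *)

Require Import Defs.
From mathcomp Require Import all_boot all_order all_algebra all_field.
From mathcomp Require Import ring lra zify.
Import Order.TTheory GRing.Theory Num.Theory.
Local Open Scope ring_scope.
Local Open Scope sesquilinear_scope.

Set Implicit Arguments.
Unset Strict Implicit.
Unset Printing Implicit Defensive.

(** * The absolute value of a Hermitian matrix *)

Definition spectral_fun (f : algC -> algC) n (A : 'M[algC]_n) : 'M[algC]_n :=
  (spectralmx A)^t* *m diag_mx (map_mx f (spectral_diag A)) *m spectralmx A.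

Lemma spectral_fun_form f n (A : 'M[algC]_n) (x : 'cV[algC]_n) :
  (x^t* *m spectral_fun f A *m x) 0 0 =
  \sum_j f (spectral_diag A 0 j) * `|(spectralmx A *m x) j 0| ^+ 2.
Proof.
have -> : x^t* *m spectral_fun f A *m x =
    (spectralmx A *m x)^t* *m
      (diag_mx (map_mx f (spectral_diag A)) *m (spectralmx A *m x)).
  by rewrite /spectral_fun !trmx_mul !map_mxM !mulmxA.
rewrite mul_diag_mx mxE; apply: eq_bigr => j _.
by rewrite !mxE normCK mulrCA; congr (_ * _); rewrite mulrC.
Qed.

Lemma mxtrace_spectral_fun f n (A : 'M[algC]_n) :
  \tr (spectral_fun f A) = \sum_j f (spectral_diag A 0 j).
Proof.
rewrite /spectral_fun mxtrace_mulC mulmxA.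
have /unitarymxP -> := spectral_unitarymx A.
by rewrite mul1mx mxtrace_diag; apply: eq_bigr => j _; rewrite !mxE.
Qed.

(* Equivalent to [y (y - t)^2 (y + 2t) >= 0]. *)
Lemma quartic_le (R : numFieldType) (y t : R) : 0 <= y -> 0 < t ->
  3 / 2 / t * y ^+ 2 - 1 / 2 / t ^+ 3 * y ^+ 4 <= y.
Proof.
move=> y0 t0; have tN0 : t != 0 by rewrite gt_eqF.
rewrite -subr_ge0 (_ : _ - _ = y * (y - t) ^+ 2 * (y + 2 * t) / (2 * t ^+ 3)).
  have yt : 0 <= (y - t) ^+ 2.
    by rewrite real_exprn_even_ge0 // rpredB ?ger0_real ?(ltW t0).
  apply: divr_ge0; last by rewrite mulr_ge0 ?exprn_ge0 ?(ltW t0).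
  apply: mulr_ge0; first exact: mulr_ge0.
  by rewrite addr_ge0 ?mulr_ge0 ?(ltW t0).
by field.
Qed.

Lemma quadratic_ge (R : numFieldType) (y t : R) : 0 <= y -> 0 < t ->
  y <= 1 / 2 / t * y ^+ 2 + t / 2.
Proof.
move=> y0 t0; have tN0 : t != 0 by rewrite gt_eqF.
rewrite -subr_ge0 (_ : _ - _ = (y - t) ^+ 2 / (2 * t)); last by field.
apply: divr_ge0; last by rewrite mulr_ge0 ?(ltW t0).
by rewrite real_exprn_even_ge0 // rpredB ?ger0_real ?(ltW t0).
Qed.

Section Hermitian.

Variables (n : nat) (A : 'M[algC]_n).
Hypothesis hermA : A \is hermsymmx.

Let spectralE :
  A = (spectralmx A)^t* *m diag_mx (spectral_diag A) *m spectralmx A.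
Proof.
rewrite -invmx_unitary ?spectral_unitarymx //.
exact/orthomx_spectralP/hermitian_normalmx.
Qed.

Lemma spectral_fun_id : spectral_fun id A = A.
Proof.
rewrite /spectral_fun (_ : map_mx _ _ = spectral_diag A) -?spectralE //.
by apply/rowP => j; rewrite mxE.
Qed.

Lemma spectral_fun_mul f g :
  spectral_fun f A *m spectral_fun g A = spectral_fun (fun x => f x * g x) A.
Proof.
rewrite /spectral_fun -!mulmxA; congr (_ *m _); rewrite !mulmxA; congr (_ *m _).
rewrite -[_ *m spectralmx A *m _]mulmxA.
have /unitarymxP -> := spectral_unitarymx A; rewrite mulmx1 mulmx_diag.
by congr diag_mx; apply/rowP => j; rewrite !mxE.
Qed.

Lemma spectral_fun_cst : spectral_fun (fun=> 1) A = 1%:M.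
Proof.
rewrite /spectral_fun (_ : map_mx _ (spectral_diag A) = const_mx 1); last first.
  by apply/rowP => j; rewrite !mxE.
rewrite diag_const_mx mulmx1.
have := spectral_unitarymx A; rewrite -trmxC_unitary => /unitarymxP.
by rewrite trmxCK.
Qed.

Lemma perm_eigenvalues_spectral :
  perm_eq (eigenvalues A) [seq spectral_diag A 0 j | j <- enum 'I_n].
Proof.
apply: prod_XsubC_eq; rewrite -char_poly_eigenvalues big_map big_enum /=.
have PP : spectralmx A *m (spectralmx A)^t* = 1%:M.
  exact/unitarymxP/spectral_unitarymx.
transitivity (char_poly (diag_mx (spectral_diag A))); last first.
  rewrite char_poly_trig ?diag_mx_is_trig //.
  by apply: eq_bigr => j _; rewrite mxE eqxx.
move: PP spectralE.
move: (spectralmx A) ((spectralmx A)^t*) (diag_mx _) => P Q D PQ ->.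
have QP : Q *m P = 1%:M by apply: mulmx1C.
rewrite /char_poly (_ : char_poly_mx (Q *m D *m P) =
    map_mx polyC Q *m char_poly_mx D *m map_mx polyC P); last first.
  rewrite /char_poly_mx mulmxBr mulmxBl !map_mxM; congr (_ - _).
  by rewrite mul_mx_scalar -scalemxAl -map_mxM QP map_mx1 scalemx1.
by rewrite !det_mulmx mulrAC -det_mulmx -map_mxM QP map_mx1 det1 mul1r.
Qed.

Lemma sum_norm_eigenvalues :
  \sum_(x <- eigenvalues A) `|x| = \tr (spectral_fun Num.norm A).
Proof.
rewrite (perm_big _ perm_eigenvalues_spectral) big_map big_enum /=.
by rewrite mxtrace_spectral_fun.
Qed.

Lemma spectral_diag_real j : spectral_diag A 0 j \is Num.real.
Proof. exact: (mxOverP (hermitian_spectral_diag_real hermA)). Qed.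

Let spectral_sqr : A *m A = spectral_fun (fun d => d * d) A.
Proof. by rewrite -(spectral_fun_mul id id) spectral_fun_id. Qed.

Let formA2 (x : 'cV_n) : (x^t* *m (A *m A) *m x) 0 0 =
  \sum_j `|spectral_diag A 0 j| ^+ 2 * `|(spectralmx A *m x) j 0| ^+ 2.
Proof.
rewrite spectral_sqr spectral_fun_form.
by apply: eq_bigr => j _; rewrite (real_normK (spectral_diag_real j)) expr2.
Qed.

Let formA4 (x : 'cV_n) : (x^t* *m (A *m A *m (A *m A)) *m x) 0 0 =
  \sum_j `|spectral_diag A 0 j| ^+ 4 * `|(spectralmx A *m x) j 0| ^+ 2.
Proof.
rewrite spectral_sqr spectral_fun_mul spectral_fun_form.
apply: eq_bigr => j _; congr (_ * _).
by rewrite (exprM _ 2 2) (real_normK (spectral_diag_real j)) !expr2.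
Qed.

Lemma norm_form_ge (x : 'cV_n) (t : algC) : 0 < t ->
  3 / 2 / t * (x^t* *m (A *m A) *m x) 0 0
    - 1 / 2 / t ^+ 3 * (x^t* *m (A *m A *m (A *m A)) *m x) 0 0
  <= (x^t* *m spectral_fun Num.norm A *m x) 0 0.
Proof.
move=> t0; rewrite formA2 formA4 spectral_fun_form !mulr_sumr -sumrB.
apply: ler_sum => j _; rewrite [X in X - _]mulrA [X in _ - X]mulrA -mulrBl.
by rewrite ler_wpM2r ?exprn_ge0 // quartic_le.
Qed.

Lemma norm_form_le (x : 'cV_n) (t : algC) : 0 < t ->
  (x^t* *m spectral_fun Num.norm A *m x) 0 0 <=
  1 / 2 / t * (x^t* *m (A *m A) *m x) 0 0 + t / 2 * (x^t* *m x) 0 0.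
Proof.
move=> t0; have -> : x^t* *m x = x^t* *m 1%:M *m x by rewrite mulmx1.
rewrite -spectral_fun_cst formA2 !spectral_fun_form !mulr_sumr -big_split.
apply: ler_sum => j _ /=; rewrite [1 * _ ^+ 2]mul1r [X in X + _]mulrA -mulrDl.
by rewrite ler_wpM2r ?exprn_ge0 // quadratic_ge.
Qed.

End Hermitian.

Section GraphForms.

Variable G : sgraph.
Implicit Types u v w : G.

Definition codeg u v : nat := #|[set w | adj u w && adj v w]|.

Definition codeg2 u v : nat := \sum_w codeg u w * codeg w v.

(* Vectors are given as linear combinations of vertices. *)
Definition qform (R : pzRingType) (f : rat -> R) (K : G -> G -> R)
    (s : seq (rat * G)) : R :=
  \sum_(p <- s) \sum_(r <- s) f p.1 * f r.1 * K p.2 r.2.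

Definition qform_rat (K : G -> G -> rat) := qform id K.

Definition absadj u v : algC :=
  spectral_fun Num.norm (adjmx G) (enum_rank u) (enum_rank v).

Definition qform_abs := qform (@ratr algC) absadj.

Lemma adjmx_herm : adjmx G \is hermsymmx.
Proof.
apply: realsym_hermsym.
  apply/is_hermitianmxP; rewrite expr0 scale1r map_mx_id //.
  by apply/matrixP => i j; rewrite !mxE adj_sym.
by apply/mxOverP => i j; rewrite mxE realn.
Qed.

Lemma energy_absadj : energy G = \sum_v absadj v v.
Proof.
rewrite /energy sum_norm_eigenvalues; last exact: adjmx_herm.
rewrite /mxtrace (reindex_onto enum_rank enum_val) /=.
  by apply: eq_bigl => v; rewrite enum_rankK eqxx.
by move=> i _; rewrite enum_valK.
Qed.

Let vect (s : seq (rat * G)) : 'cV[algC]_#|G| :=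
  \sum_(p <- s) ratr p.1 *: delta_mx (enum_rank p.2) 0.

Let form_vect (M : 'M[algC]_#|G|) (s : seq (rat * G)) :
  ((vect s)^t* *m M *m vect s) 0 0 =
  qform (@ratr algC) (fun u v => M (enum_rank u) (enum_rank v)) s.
Proof.
have -> : (vect s)^t* = \sum_(p <- s) ratr p.1 *: delta_mx 0 (enum_rank p.2).
  apply/rowP => j; rewrite !mxE !summxE rmorph_sum /=.
  apply: eq_bigr => p _; rewrite !mxE rmorphM /= conj_Crat ?Crat_rat //.
  by rewrite rmorph_nat andbT.
rewrite /vect !mulmx_suml summxE; apply: eq_bigr => p _.
rewrite mulmx_sumr summxE; apply: eq_bigr => r _.
by rewrite -!scalemxAl -scalemxAr -rowE -colE !mxE mulrA.
Qed.

Let adjmx2E u v :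
  (adjmx G *m adjmx G) (enum_rank u) (enum_rank v) = (codeg u v)%:R.
Proof.
rewrite mxE (reindex_onto enum_rank enum_val) /=; last first.
  by move=> i _; rewrite enum_valK.
rewrite (eq_bigl xpredT); last by move=> w; rewrite enum_rankK eqxx.
rewrite /codeg -sum1dep_card natr_sum [RHS]big_mkcond; apply: eq_bigr => w _.
by rewrite !mxE !enum_rankK (adj_sym w v); do 2!case: (adj _ w);
  rewrite ?mulr1 ?mul0r ?mulr0.
Qed.

Let adjmx4E u v :
  (adjmx G *m adjmx G *m (adjmx G *m adjmx G)) (enum_rank u) (enum_rank v) =
  (codeg2 u v)%:R.
Proof.
rewrite mxE (reindex_onto enum_rank enum_val) /=; last first.
  by move=> i _; rewrite enum_valK.
rewrite (eq_bigl xpredT); last by move=> w; rewrite enum_rankK eqxx.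
by rewrite natr_sum; apply: eq_bigr => w _; rewrite !adjmx2E natrM.
Qed.

Let qform_ratr (K : G -> G -> algC) (L : G -> G -> rat) s :
  (forall u v, K u v = ratr (L u v)) ->
  qform (@ratr algC) K s = ratr (qform_rat L s).
Proof.
move=> KL; rewrite /qform_rat /qform rmorph_sum; apply: eq_bigr => p _.
by rewrite rmorph_sum; apply: eq_bigr => r _; rewrite KL !rmorphM.
Qed.

Lemma qform_abs_ge s (t : rat) : 0 < t ->
  ratr (3 / 2 / t * qform_rat (fun u v => (codeg u v)%:R) s
        - 1 / 2 / t ^+ 3 * qform_rat (fun u v => (codeg2 u v)%:R) s)
  <= qform_abs s.
Proof.
move=> t0; have rt0 : 0 < ratr t :> algC by rewrite ltr0q.
have := norm_form_ge adjmx_herm (vect s) rt0; rewrite !form_vect.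
rewrite (qform_ratr (L := fun u v => (codeg u v)%:R)); last first.
  by move=> u v; rewrite adjmx2E ratr_nat.
rewrite (qform_ratr (L := fun u v => (codeg2 u v)%:R)); last first.
  by move=> u v; rewrite adjmx4E ratr_nat.
by rewrite rmorphB !rmorphM !fmorphV !rmorphXn /= !ratr_nat rmorph1 !mul1r.
Qed.

Lemma qform_abs_le s (t : rat) : 0 < t ->
  qform_abs s <=
  ratr (1 / 2 / t * qform_rat (fun u v => (codeg u v)%:R) s
        + t / 2 * qform_rat (fun u v => (u == v)%:R) s).
Proof.
move=> t0; have rt0 : 0 < ratr t :> algC by rewrite ltr0q.
have := norm_form_le adjmx_herm (vect s) rt0.
rewrite -[in X in _ + _ * X](mulmx1 (_^t*)) !form_vect.
rewrite (@qform_ratr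
  (fun u v => (adjmx G *m adjmx G) (enum_rank u) (enum_rank v))
  (fun u v => (codeg u v)%:R)); last first.
  by move=> u v; rewrite adjmx2E ratr_nat.
rewrite (@qform_ratr (fun u v => 1%:M (enum_rank u) (enum_rank v))
  (fun u v => (u == v)%:R)); last first.
  by move=> u v; rewrite mxE (inj_eq enum_rank_inj) ratr_nat.
by rewrite rmorphD !rmorphM !fmorphV /= !ratr_nat rmorph1 !mul1r.
Qed.

Lemma absadj_qform v : absadj v v = qform_abs [:: (1, v)].
Proof. by rewrite /qform_abs /qform !big_seq1 /= rmorph1 !mul1r. Qed.

End GraphForms.

(** * Closed 4-walks *)

Section Counting.

Variable G : sgraph.
Implicit Types u v w : G.

Lemma codegC u v : codeg u v = codeg v u.
Proof. by congr #|pred_of_set _|; apply/setP => w; rewrite !inE andbC. Qed.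

Lemma codeg_diag v : codeg v v = degree v.
Proof. by congr #|pred_of_set _|; apply/setP => w; rewrite !inE andbb. Qed.

Lemma codegE u v : codeg u v = (\sum_(w | adj u w) adj w v)%N.
Proof.
rewrite /codeg -sum1dep_card big_mkcondr /=; apply: eq_bigr => w _.
by rewrite adj_sym; case: adj.
Qed.

Lemma sum_codeg v : (\sum_w codeg v w = \sum_(u | adj v u) degree u)%N.
Proof.
under eq_bigr do rewrite codegE.
rewrite exchange_big; apply: eq_bigr => u _; rewrite /degree -sum1dep_card.
by rewrite [RHS]big_mkcond; apply: eq_bigr => w _; case: adj.
Qed.

(* The number of 4-cycles through [v], counted by the vertex opposite to [v]. *)
Definition squares v : nat := \sum_(w | w != v) 'C(codeg v w, 2).

Lemma codeg2_diag v :
  (codeg2 v v + degree v =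
   degree v ^ 2 + \sum_(u | adj v u) degree u + 2 * squares v)%N.
Proof.
have sqE n : (n * n = n + 2 * 'C(n, 2))%N.
  by elim: n => // n IH; rewrite binS bin1; lia.
rewrite -sum_codeg /codeg2 (bigD1 v) // [in RHS](bigD1 v) //= !codeg_diag.
under eq_bigr => w _ do rewrite (codegC w) sqE.
by rewrite big_split /= -big_distrr /= /squares; lia.
Qed.

Lemma sum_neighbors (V : nmodType) (f : G -> V) :
  \sum_v \sum_(u | adj v u) f u = \sum_u f u *+ degree u.
Proof.
rewrite (exchange_big_dep xpredT) //=; apply: eq_bigr => u _.
rewrite sumr_const; congr (_ *+ _).
by apply: eq_card => v; rewrite !inE adj_sym.
Qed.

Lemma sum_degree : (\sum_(v : G) degree v = 2 * #|edges G|)%N.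
Proof.
pose e (p : G * G) := [set p.1; p.2].
have -> : (\sum_(v : G) degree v = \sum_(p : G * G | adj p.1 p.2) 1)%N.
  under eq_bigr do rewrite /degree -sum1dep_card.
  by rewrite pair_big_dep /=; apply: eq_bigl => -[].
rewrite (partition_big e (mem (edges G))) /=; last first.
  by move=> p padj; apply/imsetP; exists p; rewrite ?inE.
rewrite mulnC -sum_nat_const; apply: eq_bigr => s /imsetP[[u v]].
rewrite inE /= => uv ->.
have uNv : u != v by apply: contraTneq uv => ->; rewrite adj_irrefl.
rewrite (bigD1 (u, v)) ?uv ?eqxx //= (bigD1 (v, u)) /=; last first.
  rewrite adj_sym uv /e /= setUC eqxx; apply/eqP => -[vu _].
  by rewrite vu eqxx in uNv.
rewrite big1 // => -[x y] /= /andP[/andP[/andP[xy /eqP exy]]].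
have : x \in e (x, y) by rewrite !inE eqxx.
have : y \in e (x, y) by rewrite !inE eqxx orbT.
rewrite exy !inE => /orP[] /eqP yE /orP[] /eqP xE.
all: rewrite xE yE ?eqxx ?adj_irrefl // in xy *.
Qed.

Definition nbr_deg k v : nat := #|[set u | adj v u && (degree u == k)]|.

Lemma leaf_nbr_uniq u v w : degree u = 1%N -> adj v u -> adj w u -> v = w.
Proof.
move=> /eqP/cards1P[x ux] vu wu.
have : v \in [set y | adj u y] by rewrite inE adj_sym.
have : w \in [set y | adj u y] by rewrite inE adj_sym.
by rewrite ux !inE => /eqP -> /eqP ->.
Qed.

Lemma codeg_leD v w : w != v -> (codeg v w + nbr_deg 1%N v <= degree v)%N.
Proof.
move=> wNv; rewrite /codeg /nbr_deg /degree.
rewrite -(cardsID [set u | adj w u] [set u | adj v u]).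
apply: leq_add.
  by apply/subset_leq_card/subsetP => u; rewrite !inE.
apply/subset_leq_card/subsetP => u; rewrite !inE => /andP[vu /eqP du].
rewrite vu andbT; apply: contra wNv => wu; apply/eqP.
exact: leaf_nbr_uniq du wu vu.
Qed.

Lemma squares_leaf v : (degree v <= (nbr_deg 1%N v).+1)%N -> squares v = 0%N.
Proof.
move=> dv; apply: big1 => w wv; apply: bin_small.
by have := codeg_leD wv; lia.
Qed.

Hypothesis deg_gt0 : forall v, (0 < degree v)%N.
Hypothesis deg_le3 : forall v, (degree v <= 3)%N.

Lemma sum_nbr_deg (V : nmodType) (f : nat -> V) v :
  \sum_(u | adj v u) f (degree u) =
  f 1%N *+ nbr_deg 1%N v + f 2%N *+ nbr_deg 2%N v + f 3%N *+ nbr_deg 3%N v.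
Proof.
have part k : f k *+ nbr_deg k v = \sum_(u | adj v u && (degree u == k)) f k.
  rewrite sumr_const; congr (_ *+ _); apply: eq_card => u.
  by rewrite !inE.
rewrite !part !big_mkcondr -!big_split /=; apply: eq_bigr => u _.
have := deg_gt0 u; have := deg_le3 u.
by case: (degree u) => [|[|[|[|]]]] //= _ _; rewrite ?addr0 ?add0r.
Qed.

Lemma degree_nbr_deg v :
  degree v = (nbr_deg 1%N v + nbr_deg 2%N v + nbr_deg 3%N v)%N.
Proof.
have := sum_nbr_deg (fun=> 1%N) v; rewrite !natn => E.
by apply: etrans E; rewrite /degree -sum1dep_card.
Qed.

Lemma codeg2_nbr_deg v :
  (codeg2 v v + degree v = degree v ^ 2 +
     (nbr_deg 1%N v + 2 * nbr_deg 2%N v + 3 * nbr_deg 3%N v) + 2 * squares v)%N.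
Proof.
rewrite codeg2_diag; congr (_ + _ + _)%N.
have mulrn_nat (x n : nat) : x *+ n = (x * n)%N.
  by elim: n => [|n IH]; rewrite ?muln0 ?mulr0n // mulrS IH mulnS.
by have := sum_nbr_deg (fun k => k) v; rewrite !mulrn_nat mul1n.
Qed.

End Counting.

(** * Discharging *)

(* The scale [t] for a vertex with [ni] neighbours of degree [i] lying on [q]
   4-cycles: a rational number near the optimum [sqrt (W4 / W2)], where [Wk] is
   the number of closed [k]-walks. *)
Definition scale (F : realFieldType) (n1 n2 n3 q : nat) : F :=
  let d := (n1 + n2 + n3)%N in
  if d == 1%N then 7 / 4 else
  if d == 2%N then if (1 < q)%N then 5 / 2 else if n1 == 0%N then 2 else 7 / 4
  else if n1 == 0%N then 12 / 5 else
  if n1 == 1%N then if (1 < q)%N then 12 / 5 else 9 / 4 else 19 / 10.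

(* What a vertex of degree [d] asks from each of its neighbours. *)
Definition demand (F : realFieldType) (ka mu : F) (d : nat) : F :=
  if d == 1%N then ka else if d == 2%N then mu else 0.

Definition charge_bound (F : realFieldType) (al ka mu la : F)
    (n1 n2 n3 q : nat) : Prop :=
  let d : F := n1%:R + n2%:R + n3%:R in let t := scale F n1 n2 n3 q in
  1 + al * (d - 2) - d * demand ka mu (n1 + n2 + n3) + (n1%:R * ka + n2%:R * mu)
    - la * q%:R
  <= 3 / 2 / t * d
     - 1 / 2 / t ^+ 3 *
       (d ^+ 2 - d + (n1%:R + 2 * n2%:R + 3 * n3%:R) + 2 * q%:R).

(* [8 * 82 < 2 * 332]: eight incidences of 4-cycles and vertices are paid by the
   excess [2 al] coming from the sum of the numbers [d - 2]. *)
Lemma charge_sparse (F : realFieldType) n1 n2 n3 q :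
  (0 < n1 + n2 + n3 <= 3)%N -> (n2 + n3 <= 1 -> q = 0)%N ->
  @charge_bound F (332 / 1000) (91 / 1000) (36 / 1000) (82 / 1000) n1 n2 n3 q.
Proof.
rewrite /charge_bound => d13 q0.
have q0R : 0 <= q%:R :> F by [].
have q0E : (n2 + n3 <= 1)%N -> q%:R = 0 :> F by move/q0 => ->.
move: d13 q0R q0E; clear q0; have [q1|q1] := leqP q 1.
  have qR : q%:R <= 1 :> F by rewrite lern1.
  rewrite /scale (ltnNge 1 q) q1 {q1} /demand; move: (q%:R : F) qR.
  by case: n1 => [|[|[|[|n1]]]]; case: n2 => [|[|[|[|n2]]]];
    case: n3 => [|[|[|[|n3]]]] Q Q1 d13 Q0 //=;
    (move=> /(_ isT) E || move=> _); lra.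
have qR : 2 <= q%:R :> F by rewrite ler_nat.
rewrite /scale q1 {q1} /demand; move: (q%:R : F) qR.
by case: n1 => [|[|[|[|n1]]]]; case: n2 => [|[|[|[|n2]]]];
  case: n3 => [|[|[|[|n3]]]] Q Q2 d13 Q0 //=;
  (move=> /(_ isT) E || move=> _); lra.
Qed.

Lemma charge_outside (F : realFieldType) n1 n2 n3 :
  (0 < n1 + n2 + n3 <= 3)%N ->
  @charge_bound F (28 / 100) (143 / 1000) 0 0 n1 n2 n3 0.
Proof.
rewrite /charge_bound /scale /demand (_ : (1 < 0)%N = false) //.
by case: n1 => [|[|[|[|n1]]]]; case: n2 => [|[|[|[|n2]]]];
  case: n3 => [|[|[|[|n3]]]] d13 //=; lra.
Qed.

Lemma scale_gt0 (F : realFieldType) n1 n2 n3 q : 0 < scale F n1 n2 n3 q.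
Proof. by rewrite /scale; do ![case: ifP => _]; lra. Qed.

Lemma charge_bound_scale (F : realFieldType) (al ka mu la : F) n1 n2 n3 q d W :
  charge_bound al ka mu la n1 n2 n3 q -> d = (n1 + n2 + n3)%N ->
  (W + d = d ^ 2 + (n1 + 2 * n2 + 3 * n3) + 2 * q)%N ->
  1 + (al * (d%:R - 2) - d%:R * demand ka mu d + (n1%:R * ka + n2%:R * mu))
    - la * q%:R <=
  3 / 2 / scale F n1 n2 n3 q * d%:R - 1 / 2 / scale F n1 n2 n3 q ^+ 3 * W%:R.
Proof.
rewrite /charge_bound -!natrD => le dE.
move=> /(congr1 (fun k => k%:R : F)); rewrite -dE in le.
rewrite !(natrD, natrM, natrX) => WE.
have -> : W%:R = d%:R ^+ 2 - d%:R + (n1%:R + 2 * n2%:R + 3 * n3%:R)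
    + 2 * q%:R :> F by lra.
by apply: le_trans le; rewrite !addrA.
Qed.

Section Charges.

Variable G : sgraph.
Implicit Types u v w : G.

Lemma absadj_ge v (t : rat) : 0 < t ->
  ratr (3 / 2 / t * (degree v)%:R - 1 / 2 / t ^+ 3 * (codeg2 v v)%:R)
    <= absadj v v.
Proof.
rewrite absadj_qform -codeg_diag => /(qform_abs_ge [:: (1, v)]).
by rewrite /qform_rat /qform !big_seq1 /= !mul1r.
Qed.

Definition charge (al ka mu : rat) v : rat :=
  al * ((degree v)%:R - 2) - (degree v)%:R * demand ka mu (degree v)
  + \sum_(u | adj v u) demand ka mu (degree u).

Lemma sum_charge al ka mu : #|edges G| = #|G|.+1 ->
  \sum_v charge al ka mu v = 2 * al.
Proof.
move=> edgesE; rewrite /charge big_split /= sum_neighbors sumrB.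
rewrite -addrA [X in - X + _](eq_bigr _ (fun v _ => mulr_natl _ _)).
rewrite [- _ + _]addNr addr0 -mulr_sumr sumrB sumr_const -natr_sum sum_degree.
by rewrite edgesE natrM -addn1 natrD -mulr_natl cardT -cardE; ring.
Qed.

Hypothesis deg_gt0 : forall v, (0 < degree v)%N.
Hypothesis deg_le3 : forall v, (degree v <= 3)%N.

Lemma sum_demand (F : realFieldType) (ka mu : F) v :
  \sum_(u | adj v u) demand ka mu (degree u) =
  (nbr_deg 1%N v)%:R * ka + (nbr_deg 2%N v)%:R * mu.
Proof.
by rewrite (sum_nbr_deg deg_gt0 deg_le3) /demand /= mul0rn addr0 !mulr_natl.
Qed.

Lemma absadj_charge al ka mu la v :
  charge_bound al ka mu la (nbr_deg 1%N v) (nbr_deg 2%N v) (nbr_deg 3%N v)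
    (squares v) ->
  ratr (1 + charge al ka mu v - la * (squares v)%:R) <= absadj v v.
Proof.
move=> le; set t := scale rat (nbr_deg 1%N v) (nbr_deg 2%N v) (nbr_deg 3%N v)
  (squares v).
have t0 : 0 < t by apply: scale_gt0.
apply: le_trans (absadj_ge v t0); rewrite ler_rat /charge sum_demand.
exact: charge_bound_scale le (degree_nbr_deg _ _ _) (codeg2_nbr_deg _ _ _).
Qed.

End Charges.

(** * The cycle space modulo 2 *)

Section CycleSpace.

Variable G : sgraph.
Implicit Types (u v w : G) (p : seq G) (e : {set G}).

Definition walk_edges p : seq {set G} :=
  [seq [set s.1; s.2] | s <- zip p (rot 1 p)].

Definition incidence : 'M['F_2]_(#|edges G|, #|G|) :=
  \matrix_(i < #|edges G|, j < #|G|) (enum_val j \in (enum_val i : {set G}))%:R.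

Definition walk_row p : 'rV['F_2]_#|edges G| :=
  \row_(i < #|edges G|) (count_mem (enum_val i) (walk_edges p))%:R.

Lemma closed_walk_adj p s : cycle (@adj G) p -> s \in zip p (rot 1 p) ->
  adj s.1 s.2.
Proof.
case: p => [|x p] //=; rewrite rot1_cons.
elim: p x {1 3}x => [|y p IH] x z /=.
  by rewrite andbT inE => xz /eqP ->.
by case/andP=> xy yp; rewrite inE => /predU1P[-> //|]; apply: IH.
Qed.

Lemma walk_edges_sub p : cycle (@adj G) p ->
  {subset walk_edges p <= edges G}.
Proof.
move=> cp _ /mapP[s /(closed_walk_adj cp) sadj ->].
by apply/imsetP; exists s; rewrite ?inE.
Qed.

Lemma walk_row_ker p : cycle (@adj G) p -> (walk_row p <= kermx incidence)%MS.
Proof.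
move=> cp; apply/sub_kermxP/rowP => j; rewrite !mxE.
set v := enum_val j.
transitivity ((\sum_(e <- walk_edges p) (v \in e))%:R : 'F_2).
  rewrite natr_sum (eq_big_seq (fun e => \sum_(i < #|edges G|)
     (enum_val i == e)%:R * (v \in enum_val i)%:R)).
    rewrite exchange_big; apply: eq_bigr => i _; rewrite !mxE -mulr_suml.
    congr (_ * _); rewrite -sum1_count natr_sum big_mkcond.
    by apply: eq_bigr => e _; rewrite /= eq_sym; case: eqP.
  move=> e /(walk_edges_sub cp) eE.
  rewrite (bigD1 (enum_rank_in eE e)) //= enum_rankK_in // eqxx mul1r.
  rewrite big1 ?addr0 // => i ie; case: eqP => [ei|]; rewrite ?mul0r //.
  by case/eqP: ie; apply: enum_val_inj; rewrite ei enum_rankK_in.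
have -> : (\sum_(e <- walk_edges p) (v \in e) = 2 * count_mem v p)%N.
  rewrite big_map (eq_big_seq (fun s => (s.1 == v) + (s.2 == v))%N); last first.
    move=> s /(closed_walk_adj cp); rewrite !inE ![v == _]eq_sym.
    by case: eqP => // ->; case: eqP => // ->; rewrite adj_irrefl.
  have sz : size p = size (rot 1 p) by rewrite size_rot.
  rewrite big_split /= -(big_map fst xpredT (fun x => (x == v) : nat)).
  rewrite -(big_map snd xpredT (fun x => (x == v) : nat)) /=.
  rewrite -/(unzip1 _) -/(unzip2 _) unzip1_zip ?unzip2_zip ?sz //.
  have cnt (q : seq G) : (\sum_(x <- q) (x == v) = count_mem v q)%N.
    by rewrite -sum1_count [RHS]big_mkcond.
  by rewrite !cnt (seq.permP (permEl (perm_rot 1 p))) mul2n addnn.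
rewrite natrM (_ : 2%:R = 0) ?mul0r //; apply/eqP.
by rewrite -(dvdn_pcharf (pchar_Fp _)).
Qed.

Lemma rank_incidence : connected G -> (#|G| <= (\rank incidence).+1)%N.
Proof.
move=> [/card_gt0P[u0 _] conn]; rewrite -mxrank_tr.
suff : (\rank (kermx incidence^T) <= 1)%N.
  by rewrite mxrank_ker leq_subLR addnC.
apply: leq_trans (rank_leq_row (const_mx 1 : 'rV['F_2]_#|G|)).
apply/mxrankS/row_subP => i; have := row_sub i (kermx incidence^T).
move: (row i _) => x /sub_kermxP xD.
have adj_eq u v : adj u v -> x 0 (enum_rank u) = x 0 (enum_rank v).
  move=> uv; have uvE : [set u; v] \in edges G.
    by apply/imsetP; exists (u, v); rewrite ?inE.
  move/rowP/(_ (enum_rank_in uvE [set u; v])): xD; rewrite !mxE.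
  rewrite (reindex_onto enum_rank enum_val) /=; last first.
    by move=> *; rewrite enum_valK.
  have uNv : u != v by apply: contraTneq uv => ->; rewrite adj_irrefl.
  rewrite (bigD1 u) ?enum_rankK //=.
  rewrite (bigD1 v) ?enum_rankK /= 1?eq_sym ?uNv ?eqxx //.
  rewrite !mxE !enum_rankK enum_rankK_in // !inE !eqxx orbT !mulr1.
  rewrite big1 => [|w /andP[/andP[_ wu] wv]]; last first.
    rewrite !mxE enum_rankK enum_rankK_in // !inE.
    by rewrite (negPf wu) (negPf wv) mulr0.
  rewrite addr0 => /eqP; rewrite addr_eq0 => /eqP ->.
  by rewrite -[RHS]opprK; apply/esym/oppr_pchar2/pchar_Fp.
rewrite [x](_ : _ = x 0 (enum_rank u0) *: const_mx 1) ?scalemx_sub //.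
apply/rowP => j; rewrite !mxE mulr1 -[j]enum_valK.
have /connectP[p] := conn u0 (enum_val j).
elim: p u0 => [|y p IH] z /=; first by move=> _ ->.
by case/andP=> /adj_eq -> yp; apply: IH.
Qed.

Lemma rank_cycle_space : bicyclic G -> (\rank (kermx incidence) <= 2)%N.
Proof.
move=> [conn]; rewrite /cyclomatic => cyc.
by have := rank_incidence conn; rewrite mxrank_ker; lia.
Qed.

(* The rows of the three walks restricted to the columns [e1], [e2], [e3] form a
   unitriangular matrix. *)
Lemma no_three_cycles p1 p2 p3 e1 e2 e3 : bicyclic G ->
  cycle (@adj G) p1 -> cycle (@adj G) p2 -> cycle (@adj G) p3 ->
  odd (count_mem e1 (walk_edges p1)) ->
  odd (count_mem e2 (walk_edges p2)) -> e2 \notin walk_edges p1 ->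
  odd (count_mem e3 (walk_edges p3)) -> e3 \notin walk_edges p1 ->
  e3 \notin walk_edges p2 -> False.
Proof.
move=> bic c1 c2 c3 o1 o2 n21 o3 n31 n32.
have E p e : cycle (@adj G) p -> odd (count_mem e (walk_edges p)) ->
    e \in edges G.
  move=> cp o; apply: (walk_edges_sub cp); rewrite -has_pred1 has_count.
  by case: count o.
have E1 := E _ _ c1 o1; have E2 := E _ _ c2 o2; have E3 := E _ _ c3 o3.
pose p (i : 'I_3) := nth [::] [:: p1; p2; p3] i.
pose e (i : 'I_3) := nth set0 [:: e1; e2; e3] i.
have eE i : e i \in edges G by case: i => -[|[|[]]].
pose V : 'M['F_2]_(3, _) := \matrix_i walk_row (p i).
pose S : 'M['F_2]_(#|edges G|, 3) := \matrix_(i, j) (enum_val i == e j)%:R.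
have VS i j : (V *m S) i j = (count_mem (e j) (walk_edges (p i)))%:R.
  rewrite mxE (bigD1 (enum_rank_in (eE j) (e j))) //= big1 => [|k kj].
    by rewrite addr0 !mxE enum_rankK_in // eqxx mulr1.
  rewrite !mxE; case: eqP => [ke|]; rewrite ?mulr0 //.
  by case/eqP: kj; apply: enum_val_inj; rewrite ke enum_rankK_in.
have rkV : (\rank V <= 2)%N.
  apply: leq_trans (rank_cycle_space bic); apply/mxrankS/row_subP => i.
  by rewrite rowK walk_row_ker //; case: i => -[|[|[]]].
have : (\rank (V *m S) <= 2)%N by apply: leq_trans (mxrankM_maxl _ _) rkV.
suff /mxrank_unit -> : V *m S \in unitmx by [].
rewrite unitmxE det_trig.
  rewrite unitfE; apply/prodf_neq0 => i _.
  rewrite VS -(dvdn_pcharf (pchar_Fp _)) //.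
  by rewrite dvdn2 negbK; case: i => -[|[|[]]].
apply/is_trig_mxP => i j ij; rewrite VS (count_memPn _) //.
by case: i j ij => -[|[|[|i]]] ? [[|[|[|j]]] ?].
Qed.

End CycleSpace.

Lemma set2_eq (T : finType) (a b c d : T) :
  [set a; b] = [set c; d] -> (a = c /\ b = d) \/ (a = d /\ b = c).
Proof.
move=> E.
have : d \in [set a; b] by rewrite E set22.
have : c \in [set a; b] by rewrite E set21.
have : b \in [set c; d] by rewrite -E set22.
have : a \in [set c; d] by rewrite -E set21.
rewrite !inE => /orP[] /eqP -> /orP[] /eqP -> /orP[] /eqP E1 /orP[] /eqP E2;
  by subst; auto.
Qed.

Lemma set2_eqE (T : finType) (a b c d : T) :
  ([set a; b] == [set c; d]) = (a == c) && (b == d) || (a == d) && (b == c).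
Proof.
apply/eqP/orP => [/set2_eq[] [-> ->]|[] /andP[/eqP -> /eqP ->]] //;
  rewrite ?eqxx; [by left | by right | exact: setUC].
Qed.

Section FourCycles.

Variable G : sgraph.
Implicit Types u v w p q r s : G.

Definition four_cycle v u w u' : Prop :=
  [/\ adj v u /\ adj u w, adj w u' /\ adj u' v, v != w & u != u'].

Definition diagonals v u w u' : {set G * G} :=
  [set (v, w); (w, v); (u, u'); (u', u)].

Lemma four_cycle_walk v u w u' :
  four_cycle v u w u' -> cycle (@adj G) [:: v; u; w; u'].
Proof. by case=> [[vu uw] [wu uv] _ _] /=; rewrite vu uw wu uv. Qed.

Lemma walk4_uniq v u w u' :
  four_cycle v u w u' -> uniq (walk_edges [:: v; u; w; u']).
Proof.
case=> [[vu uw] [wu uv] vw uu].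
have neq x y : @adj G x y -> (x == y) = false.
  by move=> xy; apply: contraTF xy => /eqP ->; rewrite adj_irrefl.
have sym x y : (x == y :> G) = false -> (y == x) = false by rewrite eq_sym.
have E := (neq _ _ vu, neq _ _ uw, neq _ _ wu, neq _ _ uv, negPf vw, negPf uu).
have E' := (sym _ _ (neq _ _ vu), sym _ _ (neq _ _ uw), sym _ _ (neq _ _ wu),
  sym _ _ (neq _ _ uv), sym _ _ (negPf vw), sym _ _ (negPf uu)).
by rewrite /= !inE !set2_eqE ?(E, E') ?andbF.
Qed.

Lemma mem_walk4 p q v u w u' :
  [set p; q] \in walk_edges [:: v; u; w; u'] ->
  (p = v /\ q = u \/ p = u /\ q = v) \/ (p = u /\ q = w \/ p = w /\ q = u) \/
  (p = w /\ q = u' \/ p = u' /\ q = w) \/ (p = u' /\ q = v \/ p = v /\ q = u').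
Proof.
rewrite !inE => /or4P[] /eqP/set2_eq H; tauto.
Qed.

Lemma walk4_diagonal p q r v u w u' : four_cycle v u w u' -> p != r ->
  [set p; q] \in walk_edges [:: v; u; w; u'] ->
  [set q; r] \in walk_edges [:: v; u; w; u'] ->
  (p, r) \in diagonals v u w u'.
Proof.
case=> [[vu uw] [wu uv] vw uu] pr /mem_walk4 pq /mem_walk4 qr.
rewrite /diagonals !inE !xpair_eqE.
move: pq qr; do !case; move=> Ep Eq; do !case; move=> Eq' Er; subst;
  by [rewrite adj_irrefl in vu | rewrite adj_irrefl in uw |
      rewrite adj_irrefl in wu | rewrite adj_irrefl in uv |
      rewrite eqxx in pr | rewrite eqxx in vw | rewrite eqxx in uu |
      rewrite !eqxx ?orbT].
Qed.

Lemma walk4_opposite p q r s v u w u' : four_cycle v u w u' ->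
  four_cycle p q r s ->
  [set p; q] \in walk_edges [:: v; u; w; u'] ->
  [set r; s] \in walk_edges [:: v; u; w; u'] ->
  [set q; r] \in walk_edges [:: v; u; w; u'] \/ adj p r /\ adj q s.
Proof.
case=> [[vu uw] [wu uv] vw uu] [[pq qr] [rs sp] pr qs].
move=> /mem_walk4 PQ /mem_walk4 RS.
have {}qr : q != r by apply: contraTneq _ _ qr => ->; rewrite adj_irrefl.
have {}sp : s != p by apply: contraTneq _ _ sp => ->; rewrite adj_irrefl.
have [vu' [uw' [wu' uv']]] : adj u v /\ adj w u /\ adj u' w /\ adj v u'.
  by do !split; rewrite adj_sym.
move: PQ RS; do !case; move=> Ep Eq; do !case; move=> Er Es; subst;
  try (by right); try by [rewrite eqxx in pr | rewrite eqxx in qs |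
    rewrite eqxx in qr | rewrite eqxx in sp].
  all: by left; rewrite !inE 1?[[set u; v]]setUC 1?[[set w; u]]setUC
    1?[[set u'; w]]setUC 1?[[set v; u']]setUC ?eqxx ?orbT.
Qed.

Hypothesis codeg_le2 : forall v w, v != w -> (codeg v w <= 2)%N.

Lemma common_nbrs v u w u' : four_cycle v u w u' ->
  [set x | adj v x && adj w x] = [set u; u'].
Proof.
case=> [[vu uw] [wu uv] vw uu]; apply/esym/eqP; rewrite eqEcard cards2 uu.
rewrite codeg_le2 // andbT; apply/subsetP => x.
by rewrite !inE => /orP[] /eqP ->;
  rewrite ?vu ?wu ?(adj_sym w) ?(adj_sym v) ?uw ?uv.
Qed.

Lemma four_cycle_rot v u w u' : four_cycle v u w u' -> four_cycle u w u' v.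
Proof. by case=> [[? ?] [? ?] ? ?]; split; rewrite // eq_sym. Qed.

Lemma diagonal_swap p q r s v u w u' : four_cycle v u w u' ->
  four_cycle p q r s -> (q, s) \in diagonals v u w u' ->
  (p, r) \in diagonals v u w u'.
Proof.
move=> C D; have [_ _ pr _] := D.
have ND := common_nbrs (four_cycle_rot D).
have NC := common_nbrs C; have NC' := common_nbrs (four_cycle_rot C).
have sw (a b : G) : [set x | adj a x && adj b x] = [set x | adj b x && adj a x].
  by apply/setP => x; rewrite !inE andbC.
rewrite /diagonals !inE !xpair_eqE -!orbA.
case/or4P=> /andP[/eqP Eq /eqP Es]; move: ND; rewrite Eq Es => ND.
- by move: ND; rewrite NC => /set2_eq[] [-> ->]; rewrite !eqxx ?orbT.
- by move: ND; rewrite sw NC => /set2_eq[] [-> ->]; rewrite !eqxx ?orbT.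
- by move: ND; rewrite NC' => /set2_eq[] [-> ->]; rewrite !eqxx ?orbT.
- by move: ND; rewrite sw NC' => /set2_eq[] [-> ->]; rewrite !eqxx ?orbT.
Qed.

Definition twins : {set G * G} :=
  [set s | (s.1 != s.2) && (codeg s.1 s.2 == 2)].

Lemma twins_four_cycle (s : G * G) : s \in twins ->
  exists u u', four_cycle s.1 u s.2 u'.
Proof.
rewrite inE => /andP[vw c2]; have /cards2P[u [u' [uu E]]] := c2.
exists u, u'.
have : u \in [set u; u'] by rewrite set21.
have : u' \in [set u; u'] by rewrite set22.
rewrite -E !inE => /andP[vu' wu'] /andP[vu wu].
by split=> //; split; rewrite // adj_sym.
Qed.

Lemma no_K4 p q r s : bicyclic G -> four_cycle p q r s -> adj p r -> adj q s ->
  False.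
Proof.
move=> bic [[pq qr] [rs sp] pr qs] Apr Aqs.
have neq x y : @adj G x y -> (x == y) = false.
  by move=> xy; apply: contraTF xy => /eqP ->; rewrite adj_irrefl.
have [qr' [rs' [sp' [pq' [Apr' Aqs']]]]] :
    adj r q /\ adj s r /\ adj p s /\ adj q p /\ adj r p /\ adj s q.
  by do !split; rewrite adj_sym.
have E := (neq _ _ pq, neq _ _ qr, neq _ _ rs, neq _ _ sp, negPf pr, negPf qs,
           neq _ _ qr', neq _ _ rs', neq _ _ sp', neq _ _ pq',
           neq _ _ Apr', neq _ _ Aqs').
apply: (@no_three_cycles G [:: p; q; r] [:: p; q; s] [:: p; r; s]
  [set q; r] [set q; s] [set r; s]) => //=.
- by rewrite pq qr Apr'.
- by rewrite pq Aqs sp.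
- by rewrite Apr rs sp.
- by rewrite !set2_eqE !E !eqxx.
- by rewrite !set2_eqE !E !eqxx.
- by rewrite !inE !set2_eqE !E !eqxx.
- by rewrite !set2_eqE !E !eqxx.
- by rewrite !inE !set2_eqE !E !eqxx.
- by rewrite !inE !set2_eqE !E !eqxx.
Qed.

Lemma no_three_four_cycles v1 u1 w1 x1 v2 u2 w2 x2 p q r s : bicyclic G ->
  four_cycle v1 u1 w1 x1 -> four_cycle v2 u2 w2 x2 -> four_cycle p q r s ->
  (v2, w2) \notin diagonals v1 u1 w1 x1 ->
  (p, r) \notin diagonals v1 u1 w1 x1 ->
  (p, r) \notin diagonals v2 u2 w2 x2 -> False.
Proof.
move=> bic C1 C2 C3 n12 n13 n23.
set W1 := walk_edges [:: v1; u1; w1; x1].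
set W2 := walk_edges [:: v2; u2; w2; x2].
have once v u w x : four_cycle v u w x -> forall e,
    e \in walk_edges [:: v; u; w; x] ->
    odd (count_mem e (walk_edges [:: v; u; w; x])).
  by move=> C e eE; rewrite count_uniq_mem ?walk4_uniq ?eE.
have [e2 e2W2 e2W1] : exists2 e, e \in W2 & e \notin W1.
  have [uvW1|] := boolP ([set v2; u2] \in W1); last first.
    by exists [set v2; u2]; rewrite // !inE eqxx.
  exists [set u2; w2]; first by rewrite !inE eqxx orbT.
  apply: contra n12 => uwW1; case: C2 => _ _ vw _.
  exact: (walk4_diagonal C1 vw uvW1 uwW1).
have W12 e : e \in walk_edges [:: p; q; r; s] -> e \notin W1 -> e \in W2.
  move=> eW3 eW1; apply: contraT => eW2; exfalso.
  apply: (no_three_cycles bic (four_cycle_walk C1) (four_cycle_walk C2)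
    (four_cycle_walk C3) (e1 := [set v1; u1]) (once _ _ _ _ C1 _ _)
    (once _ _ _ _ C2 _ e2W2) e2W1 (once _ _ _ _ C3 _ eW3) eW1 eW2).
  by rewrite !inE eqxx.
have [_ _ pr qs] := C3.
have alt v u w x : four_cycle v u w x -> (p, r) \notin diagonals v u w x ->
   [set p; q] \in walk_edges [:: v; u; w; x] ->
   [set r; s] \in walk_edges [:: v; u; w; x] -> False.
  move=> C n PQ RS; have [QR|[]] := walk4_opposite C C3 PQ RS.
    by case/negP: n; apply: walk4_diagonal C pr PQ QR.
  exact: no_K4 bic C3.
have nqs v u w x : four_cycle v u w x -> (p, r) \notin diagonals v u w x ->
    (q, s) \notin diagonals v u w x.
  by move=> C; apply: contra => qsC; apply: diagonal_swap C C3 qsC.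
have [PQ|PQ] := boolP ([set p; q] \in W1).
  apply: (alt _ _ _ _ C1 n13 PQ).
  have QR : [set q; r] \in W2.
    apply: W12; first by rewrite !inE eqxx ?orbT.
    by apply: contra n13 => QR; apply: walk4_diagonal C1 pr PQ QR.
  apply: contraT => RS; have {}RS := W12 _ _ RS.
  case/negP: (nqs _ _ _ _ C2 n23).
  by apply: walk4_diagonal C2 qs QR (RS _); rewrite !inE eqxx ?orbT.
have {}PQ : [set p; q] \in W2 by apply: W12 PQ; rewrite !inE eqxx.
apply: (alt _ _ _ _ C2 n23 PQ).
have QR : [set q; r] \in W1.
  apply: contraT => QR; case/negP: n23; apply: walk4_diagonal C2 pr PQ _.
  by apply: W12 QR; rewrite !inE eqxx ?orbT.
apply: W12; first by rewrite !inE eqxx ?orbT.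
apply: contra (nqs _ _ _ _ C1 n13) => RS.
exact: walk4_diagonal C1 qs QR RS.
Qed.

Lemma card_twins : bicyclic G -> (#|twins| <= 8)%N.
Proof.
move=> bic; rewrite leqNgt; apply/negP => gt8.
have cardD v u w x : (#|diagonals v u w x| <= 4)%N.
  by rewrite /diagonals -!setUA !(cardsU1, cards1); do ![case: (_ \notin _)].
have [t1 t1T] : exists t1, t1 \in twins.
  by apply/set0Pn; rewrite -card_gt0; apply: leq_trans gt8.
have [u1 [x1 C1]] := twins_four_cycle t1T.
set D1 := diagonals t1.1 u1 t1.2 x1.
have escape (D : {set G * G}) : (#|D| <= 8)%N ->
    exists2 t, t \in twins & t \notin D.
  move=> D8; apply/subsetPn; apply/negP => /subset_leq_card; lia.
have [|t2 t2T t2D] := escape D1; first by apply: leq_trans (cardD _ _ _ _) _.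
have [u2 [x2 C2]] := twins_four_cycle t2T.
set D2 := diagonals t2.1 u2 t2.2 x2.
have [|t3 t3T] := escape (D1 :|: D2).
  apply: leq_trans (leq_card_setU _ _) _.
  by rewrite (leq_add (cardD _ _ _ _) (cardD _ _ _ _)).
rewrite inE negb_or => /andP[t3D1 t3D2].
have [u3 [x3 C3]] := twins_four_cycle t3T.
by apply: (no_three_four_cycles bic C1 C2 C3); rewrite -surjective_pairing.
Qed.

Lemma sum_squares : (\sum_(v : G) squares v = #|twins|)%N.
Proof.
rewrite /squares pair_big_dep /= -sum1dep_card.
rewrite (eq_bigl (fun s : G * G => s.1 != s.2)); last first.
  by move=> s; rewrite eq_sym.
rewrite [RHS]big_mkcondr; apply: eq_bigr => -[v w] /= vw.
by have := codeg_le2 vw; case: (codeg v w) => [|[|[|]]].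
Qed.

End FourCycles.

Section Bicyclic.

Variable G : sgraph.
Implicit Types u v w : G.
Hypothesis bicG : bicyclic G.
Hypothesis deg_le3 : forall v, (degree v <= 3)%N.

Lemma bicyclic_edges : #|edges G| = #|G|.+1.
Proof. by case: bicG => _; rewrite /cyclomatic; lia. Qed.

Lemma bicyclic_degree_gt0 v : (0 < degree v)%N.
Proof.
rewrite lt0n; apply/eqP => dv0.
have [[_ conn] _] := bicG.
have vE u : u = v.
  have /connectP[[|w p] /=] := conn v u; first by move=> _ ->.
  have /eqP := dv0; rewrite cards_eq0 => /eqP/setP/(_ w).
  by rewrite !inE => ->.
have := sum_degree G; rewrite bicyclic_edges (bigD1 v) //= dv0 big1 //.
by move=> u; rewrite (vE u) eqxx.
Qed.

Lemma energy_gt_sparse :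
  (forall v w, v != w -> (codeg v w <= 2)%N) -> #|G|%:R < energy G.
Proof.
move=> codeg_le2; rewrite energy_absadj.
pose al : rat := 332 / 1000; pose la : rat := 82 / 1000.
pose ch := charge al (91 / 1000) (36 / 1000) : G -> rat.
apply: (@lt_le_trans _ _
    (ratr (\sum_v (1 + ch v - la * (squares v)%:R)))); last first.
  rewrite rmorph_sum; apply: ler_sum => v _.
  apply: (absadj_charge bicyclic_degree_gt0 deg_le3).
  have dE := degree_nbr_deg bicyclic_degree_gt0 deg_le3 v.
  apply: charge_sparse; first by rewrite -dE bicyclic_degree_gt0 deg_le3.
  by move=> n23; apply: squares_leaf; rewrite dE; lia.
rewrite -ratr_nat ltr_rat sumrB big_split /= sum_charge ?bicyclic_edges //.
rewrite sumr_const -mulr_sumr -natr_sum sum_squares //.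
have : #|@twins G|%:R <= 8 :> rat by rewrite ler_nat card_twins.
by rewrite cardT -cardE /al /la; lra.
Qed.

End Bicyclic.

(** * Bicyclic graphs containing K_{2,3} *)

Definition is_K23 (G : sgraph) (x y a b c : G) : Prop :=
  [/\ x != y, uniq [:: a; b; c],
      forall u, adj x u = (u \in [:: a; b; c]) &
      forall u, adj y u = (u \in [:: a; b; c])].

Lemma is_K23_perm (G : sgraph) (x y a b c a' b' c' : G) :
  perm_eq [:: a; b; c] [:: a'; b'; c'] ->
  is_K23 x y a b c -> is_K23 x y a' b' c'.
Proof.
move=> P [xy U Nx Ny]; split=> // [|u|u]; first by rewrite -(perm_uniq P).
  by rewrite Nx (perm_mem P).
by rewrite Ny (perm_mem P).
Qed.

Lemma is_K23_perms (G : sgraph) (x y a b c : G) : is_K23 x y a b c ->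
  [/\ is_K23 x y b a c, is_K23 x y c a b, is_K23 x y a c b, is_K23 x y b c a
    & is_K23 x y c b a].
Proof.
by move=> K; split; apply: is_K23_perm K; apply/seq.permP => P /=; lia.
Qed.

Lemma is_K23_swap (G : sgraph) (x y a b c : G) :
  is_K23 x y a b c -> is_K23 y x a b c.
Proof. by case=> xy U Nx Ny; split; rewrite // eq_sym. Qed.

Section K23Walks.

Variable G : sgraph.
Hypothesis bicG : bicyclic G.
Variables x y a b c : G.
Hypothesis K : is_K23 x y a b c.

Let xy : x != y. Proof. by case: K. Qed.
Let Nx u : adj x u = (u \in [:: a; b; c]). Proof. by case: K. Qed.
Let Ny u : adj y u = (u \in [:: a; b; c]). Proof. by case: K. Qed.

Let adj_neq u v : @adj G u v -> (u == v) = false.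
Proof. by move=> uv; apply: contraTF uv => /eqP ->; rewrite adj_irrefl. Qed.

Lemma K23_uniq : uniq [:: x; y; a; b; c].
Proof.
have [_ U _ _] := K.
have xN : x \notin [:: a; b; c] by rewrite -Nx adj_irrefl.
have yN : y \notin [:: a; b; c] by rewrite -Ny adj_irrefl.
by rewrite cons_uniq inE negb_or xy xN cons_uniq yN U.
Qed.

Lemma K23_eqF :
  (((x == y) = false) * ((x == a) = false) * ((x == b) = false)
   * ((x == c) = false) * ((y == a) = false) * ((y == b) = false)
   * ((y == c) = false) * ((a == b) = false) * ((a == c) = false)
   * ((b == c) = false)) *
  (((y == x) = false) * ((a == x) = false) * ((b == x) = false)
   * ((c == x) = false) * ((a == y) = false) * ((b == y) = false)
   * ((c == y) = false) * ((b == a) = false) * ((c == a) = false)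
   * ((c == b) = false)).
Proof.
have := K23_uniq; rewrite /= !inE !negb_or.
case/and5P=> /and4P[? ? ? ?] /and3P[? ? ?] /andP[? ?] ? _.
by do !split; apply/negbTE; rewrite // eq_sym.
Qed.

Lemma K23_adj u : u \in [:: a; b; c] -> adj x u /\ adj y u.
Proof. by rewrite Nx Ny. Qed.

(* Two 4-cycles of [K_{2,3}] are independent modulo 2, so no further closed walk
   uses an edge outside [K_{2,3}] an odd number of times. *)
Lemma K23_walk_edges p u v : cycle (@adj G) p ->
  u \notin [:: x; y] -> v \notin [:: x; y] ->
  ~~ odd (count_mem [set u; v] (walk_edges p)).
Proof.
move=> cp uxy vxy; apply/negP => o.
have [xa ya] : adj x a /\ adj y a by apply: K23_adj; rewrite inE eqxx.
have [xb yb] : adj x b /\ adj y b by apply: K23_adj; rewrite !inE eqxx orbT.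
have [xc yc] : adj x c /\ adj y c by apply: K23_adj; rewrite !inE eqxx !orbT.
have C d : adj x d -> adj y d -> (a == d) = false -> four_cycle x a y d.
  by move=> xd yd ad; split; rewrite ?ad //; split; rewrite // adj_sym.
have Cb : four_cycle x a y b by apply: C; rewrite ?K23_eqF.
have Cc : four_cycle x a y c by apply: C; rewrite ?K23_eqF.
have out d : [set u; v] \notin walk_edges [:: x; a; y; d].
  move: uxy vxy; rewrite !inE !negb_or => /andP[/negPf ux /negPf uy].
  case/andP=> /negPf vx /negPf vy.
  by rewrite !set2_eqE ux uy vx vy !andbF.
apply: (no_three_cycles bicG (four_cycle_walk Cb) (four_cycle_walk Cc) cp
  (e1 := [set x; a]) (e2 := [set c; x]) _ _ _ o (out b) (out c)).
- by rewrite count_uniq_mem ?walk4_uniq // !inE eqxx.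
- by rewrite count_uniq_mem ?walk4_uniq // !inE eqxx !orbT.
- by rewrite !inE !set2_eqE !K23_eqF !andbF.
Qed.

Lemma K23_legs_nadj : ~~ adj a b.
Proof.
apply/negP => ab.
have [xa ya] : adj x a /\ adj y a by apply: K23_adj; rewrite inE eqxx.
have [xb yb] : adj x b /\ adj y b by apply: K23_adj; rewrite !inE eqxx orbT.
have := @K23_walk_edges [:: x; a; b] a b.
rewrite /= xa ab adj_sym xb !inE !set2_eqE !K23_eqF !eqxx.
by move=> /(_ isT isT isT).
Qed.

Lemma K23_common_nbr p : adj a p -> adj b p -> p \in [:: x; y].
Proof.
move=> ap bp; apply: contraT => pxy.
have [xa ya] : adj x a /\ adj y a by apply: K23_adj; rewrite inE eqxx.
have [xb yb] : adj x b /\ adj y b by apply: K23_adj; rewrite !inE eqxx orbT.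
have := @K23_walk_edges [:: x; a; p; b] a p.
rewrite /= xa ap (adj_sym p) bp (adj_sym b) xb pxy.
rewrite !inE !set2_eqE !K23_eqF !eqxx.
move: pxy; rewrite !inE negb_or => /andP[/negPf px /negPf py].
rewrite (eq_sym x p) px (adj_neq ap) (adj_neq bp) !andbF.
by move=> /(_ isT isT isT).
Qed.

Lemma K23_no_six_walk p w q : adj a p -> adj p w -> adj w q -> adj q b ->
  p \notin [:: x; y] -> w != a -> False.
Proof.
move=> ap pw wq qb pxy wa.
have [xa ya] : adj x a /\ adj y a by apply: K23_adj; rewrite inE eqxx.
have [xb yb] : adj x b /\ adj y b by apply: K23_adj; rewrite !inE eqxx orbT.
have pb : (b == p) = false.
  by apply: contraNF K23_legs_nadj => /eqP ->.
have := @K23_walk_edges [:: x; a; p; w; q; b] a p.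
rewrite /= xa ap pw wq qb (adj_sym b) xb pxy !inE !set2_eqE !K23_eqF !eqxx.
move: pxy; rewrite !inE negb_or => /andP[/negPf px /negPf py].
rewrite (eq_sym x p) px (eq_sym p a) (adj_neq ap) (negPf wa) (eq_sym w p).
by rewrite (adj_neq pw) pb !andbF => /(_ isT isT isT).
Qed.

Lemma K23_four_cycle v u w u' : four_cycle v u w u' ->
  v \in [:: x; y] /\ w \in [:: x; y] \/
  v \in [:: a; b; c] /\ w \in [:: a; b; c].
Proof.
move=> C; have [[vu uw] [wu uv] vw uu] := C.
have edge p q : [set p; q] \in walk_edges [:: v; u; w; u'] ->
    (p \in [:: x; y]) || (q \in [:: x; y]).
  move=> pq; apply: contraT; rewrite negb_or => /andP[pxy qxy].
  have := K23_walk_edges (four_cycle_walk C) pxy qxy.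
  by rewrite count_uniq_mem ?walk4_uniq // pq.
have /orP E1 : (v \in [:: x; y]) || (u \in [:: x; y]).
  by apply: edge; rewrite !inE eqxx.
have /orP E2 : (u \in [:: x; y]) || (w \in [:: x; y]).
  by apply: edge; rewrite !inE eqxx !orbT.
have /orP E3 : (w \in [:: x; y]) || (u' \in [:: x; y]).
  by apply: edge; rewrite !inE eqxx !orbT.
have /orP E4 : (u' \in [:: x; y]) || (v \in [:: x; y]).
  by apply: edge; rewrite !inE eqxx !orbT.
have leg p q : p \in [:: x; y] -> adj p q -> q \in [:: a; b; c].
  by rewrite !inE => /orP[] /eqP ->; rewrite ?Nx ?Ny !inE.
have hub p : p \in [:: x; y] -> p \notin [:: a; b; c].
  by rewrite !inE => /orP[] /eqP ->; rewrite !K23_eqF.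
have [vxy|vxy] := boolP (v \in [:: x; y]).
  left; split=> //; case: E2 => // uxy.
  by have := hub _ uxy; rewrite (leg _ _ vxy vu).
right; case: E1 => [|uxy]; first by rewrite (negPf vxy).
by split; [apply: leg uxy _; rewrite adj_sym | apply: leg uxy uw].
Qed.

End K23Walks.

Section K23Codegrees.

Variable G : sgraph.
Hypothesis bicG : bicyclic G.
Hypothesis deg_le3 : forall v : G, (degree v <= 3)%N.
Implicit Types u v w x y a b c : G.

Lemma K23_degree x y a b c : is_K23 x y a b c -> degree x = 3%N.
Proof.
case=> _ U Nx _; rewrite /degree -[3%N]/(size [:: a; b; c]) -(card_uniqP U).
by apply: eq_card => u; rewrite inE Nx.
Qed.

Lemma K23_codeg_hub x y a b c : is_K23 x y a b c -> codeg x y = 3%N.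
Proof.
case=> _ U Nx Ny; rewrite /codeg -[3%N]/(size [:: a; b; c]) -(card_uniqP U).
by apply: eq_card => u; rewrite inE Nx Ny andbb.
Qed.

Lemma K23_codeg_leg x y a b c : is_K23 x y a b c -> codeg a b = 2%N.
Proof.
move=> K; transitivity #|[set x; y]|; last by rewrite cards2 (K23_eqF K).
apply: eq_card => p; rewrite !inE; apply/andP/idP => [[ap bp]|].
  by have := K23_common_nbr bicG K ap bp; rewrite !inE.
have [_ _ Nx Ny] := K.
by case/orP=> /eqP ->; rewrite (adj_sym a) (adj_sym b) ?Nx ?Ny !inE !eqxx
  ?orbT.
Qed.

Lemma K23_codeg_le1 x y a b c v w : is_K23 x y a b c -> v != w ->
  ~~ ((v \in [:: x; y]) && (w \in [:: x; y])) ->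
  ~~ ((v \in [:: a; b; c]) && (w \in [:: a; b; c])) ->
  (codeg v w <= 1)%N.
Proof.
move=> K vw nxy nabc; rewrite leqNgt; apply/negP => /card_gt1P[u [u' []]].
rewrite !inE => /andP[vu wu] /andP[vu' wu'] uu.
have C : four_cycle v u w u' by split=> //; split; rewrite // adj_sym.
case: (K23_four_cycle bicG K C) => -[V W].
  by rewrite V W in nxy.
by rewrite V W in nabc.
Qed.

Lemma K23_squares_hub x y a b c : is_K23 x y a b c -> squares x = 3%N.
Proof.
move=> K; rewrite /squares (bigD1 y) ?(K23_eqF K) //= (K23_codeg_hub K).
rewrite big1 // => w /andP[wx wy]; apply: bin_small; rewrite ltnS.
apply: (K23_codeg_le1 K); first by rewrite eq_sym.
  by rewrite !inE (negPf wx) (negPf wy) andbF.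
by rewrite !inE !(K23_eqF K).
Qed.

Lemma K23_squares_leg x y a b c : is_K23 x y a b c -> squares a = 2%N.
Proof.
move=> K; have [_ _ K' _ _] := is_K23_perms K.
rewrite /squares (bigD1 b) ?(K23_eqF K) //= (bigD1 c) ?(K23_eqF K) //=.
rewrite (K23_codeg_leg K) (K23_codeg_leg K').
rewrite big1 // => w /andP[/andP[wa wb] wc]; apply: bin_small; rewrite ltnS.
apply: (K23_codeg_le1 K); first by rewrite eq_sym.
  by rewrite !inE !(K23_eqF K).
by rewrite !inE (negPf wa) (negPf wb) (negPf wc) andbF.
Qed.

Lemma K23_squares_outside x y a b c v : is_K23 x y a b c ->
  v \notin [:: x; y; a; b; c] -> squares v = 0%N.
Proof.
move=> K; rewrite !inE !negb_or => /and5P[vx vy va vb vc].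
apply: big1 => w wv; apply: bin_small; rewrite ltnS.
apply: (K23_codeg_le1 K); first by rewrite eq_sym.
  by rewrite !inE (negPf vx) (negPf vy).
by rewrite !inE (negPf va) (negPf vb) (negPf vc).
Qed.

Lemma K23_codeg2_leg x y a b c : is_K23 x y a b c ->
  codeg2 a b = (2 * (degree a + degree b) + 4)%N.
Proof.
move=> K; have [_ _ K' _ K''] := is_K23_perms K.
rewrite /codeg2 (bigD1 a) //= (bigD1 b) ?(K23_eqF K) //=.
rewrite (bigD1 c) ?(K23_eqF K) //= !codeg_diag (K23_codeg_leg K).
rewrite (K23_codeg_leg K') (K23_codeg_leg K'') big1; first by lia.
move=> w /andP[/andP[wa wb] wc]; apply/eqP; rewrite muln_eq0 !eqn0Ngt -negb_and.
apply/negP => /andP[].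
rewrite /codeg => /card_gt0P[p] /[!inE] /andP[ap wp].
move=> /card_gt0P[q] /[!inE] /andP[wq bq].
apply: (K23_no_six_walk bicG K ap _ wq _ _ wa); rewrite 1?adj_sym //.
have [_ _ Nx Ny] := K.
apply/negP; rewrite !inE => /orP[] /eqP pE; move: wp;
  by rewrite pE adj_sym ?Nx ?Ny !inE (negPf wa) (negPf wb) (negPf wc).
Qed.

Lemma K23_nbr_deg3 x y a b c : is_K23 x y a b c -> (1 < nbr_deg 3 a)%N.
Proof.
move=> K; apply/card_gt1P; exists x, y; have [xy _ Nx Ny] := K.
rewrite !inE (K23_degree K) (K23_degree (is_K23_swap K)) xy ![adj a _]adj_sym.
by rewrite Nx Ny !inE !eqxx.
Qed.

End K23Codegrees.

(* In a [K_{2,3}] with parts {x, y} and {a, b, c}: the lower bounds with scale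
   [t] for the form of [|A|] at [x], and at [r a + s b + z c].  Here [da] and
   [ka] are the degree of [a] and the number of closed 4-walks at [a]. *)
Definition hub_bound (F : realFieldType) (t da db dc : F) : F :=
  3 / 2 / t * 3 - 1 / 2 / t ^+ 3 * (12 + da + db + dc).

Definition leg_bound (F : realFieldType) (t r s z da db dc ka kb kc : F) : F :=
  3 / 2 / t * (r ^+ 2 * da + s ^+ 2 * db + z ^+ 2 * dc
               + 4 * (r * s + r * z + s * z))
  - 1 / 2 / t ^+ 3 *
    (r ^+ 2 * ka + s ^+ 2 * kb + z ^+ 2 * kc
     + 2 * (r * s * (2 * (da + db) + 4) + r * z * (2 * (da + dc) + 4)
            + s * z * (2 * (db + dc) + 4))).

(* For a degree 3 vertex in the part of three, [k - 16] is the degree of its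
   neighbour outside [K_{2,3}]. *)
Definition long_leg (F : realFieldType) (d k cost : F) : Prop :=
  d = 3 /\ (k = 17 /\ cost = 28 / 100 + 143 / 1000 \/
            18 <= k <= 19 /\ cost = 28 / 100).

Definition short_leg (F : realFieldType) (d k cost : F) : Prop :=
  [/\ d = 2, k = 12 & cost = 0].

(* The vectors (4, 3, 3), (3, -2, -2), (0, 1, -1) are orthogonal, of squared
   norms 34, 17, 2; the basis (1, 1, 1), (1, -1, 0), (1, 1, -2) that suffices
   below is not good enough here. *)
Lemma one_long_leg (F : realFieldType) (da db dc ka kb kc fa fb fc : F) :
  long_leg da ka fa -> short_leg db kb fb -> short_leg dc kc fc ->
  5 + (fa + fb + fc) < 2 * hub_bound (5 / 2) da db dc
    + leg_bound (51 / 20) 4 3 3 da db dc ka kb kc / 34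
    + leg_bound (11 / 7) 3 (- 2) (- 2) da db dc ka kb kc / 17
    + leg_bound 1 0 1 (- 1) da db dc ka kb kc / 2.
Proof.
rewrite /hub_bound /leg_bound => -[-> A] [-> -> ->] [-> -> ->].
by case: A => [[-> ->]|[/andP[k1 k2] ->]]; lra.
Qed.

Lemma many_long_legs (F : realFieldType) (da db dc ka kb kc fa fb fc : F) :
  long_leg da ka fa -> long_leg db kb fb ->
  long_leg dc kc fc \/ short_leg dc kc fc ->
  5 + (fa + fb + fc) < 2 * hub_bound (13 / 5) da db dc
    + leg_bound (13 / 5) 1 1 1 da db dc ka kb kc / 3
    + leg_bound (7 / 4) 1 (- 1) 0 da db dc ka kb kc / 2
    + leg_bound (7 / 4) 1 1 (- 2) da db dc ka kb kc / 6.
Proof.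
rewrite /hub_bound /leg_bound => -[-> A] [-> B] [[-> C]|[-> -> ->]].
  by case: A => [[-> ->]|[/andP[k1 k2] ->]];
    case: B => [[-> ->]|[/andP[k3 k4] ->]];
    case: C => [[-> ->]|[/andP[k5 k6] ->]]; lra.
by case: A => [[-> ->]|[/andP[k1 k2] ->]];
  case: B => [[-> ->]|[/andP[k3 k4] ->]]; lra.
Qed.

Lemma qform3 (R : comPzRingType) (f : rat -> R) (G : sgraph) (K : G -> G -> R)
    (r s z : rat) (u v w : G) :
  qform f K [:: (r, u); (s, v); (z, w)] =
  f r ^+ 2 * K u u + f s ^+ 2 * K v v + f z ^+ 2 * K w w
  + f r * f s * (K u v + K v u) + f r * f z * (K u w + K w u)
  + f s * f z * (K v w + K w v).
Proof. by rewrite /qform !big_cons !big_nil /=; ring. Qed.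

Lemma qform2 (R : comPzRingType) (f : rat -> R) (G : sgraph) (K : G -> G -> R)
    (r s : rat) (u v : G) :
  qform f K [:: (r, u); (s, v)] =
  f r ^+ 2 * K u u + f s ^+ 2 * K v v + f r * f s * (K u v + K v u).
Proof. by rewrite /qform !big_cons !big_nil /=; ring. Qed.

Lemma codeg2C (G : sgraph) (u v : G) : codeg2 u v = codeg2 v u.
Proof.
apply: eq_bigr => w _; rewrite mulnC (codegC w) (codegC u) //.
Qed.

Section K23Energy.

Variable G : sgraph.
Hypothesis bicG : bicyclic G.
Hypothesis deg_le3 : forall v : G, (degree v <= 3)%N.
Implicit Types u v w x y a b c : G.

Let deg_gt0 := bicyclic_degree_gt0 bicG.

Definition leg_cost (F : realFieldType) (al ka : F) a : F :=
  al * ((degree a)%:R - 2) + \sum_(u | adj a u) demand ka 0 (degree u).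

Lemma K23_sum_legs (V : nmodType) (f : G -> V) x y a b c :
  is_K23 x y a b c -> \sum_(u | adj x u) f u = f a + f b + f c.
Proof.
case=> _ U Nx _; transitivity (\sum_(u <- [:: a; b; c]) f u).
  by rewrite big_uniq //; apply: eq_bigl => u; rewrite Nx.
by rewrite !big_cons big_nil addr0 addrA.
Qed.

Lemma K23_leg_degree x y a b c : is_K23 x y a b c ->
  degree a = 2%N \/ degree a = 3%N.
Proof.
move=> K; have := deg_le3 a; have := K23_nbr_deg3 K.
by have := degree_nbr_deg deg_gt0 deg_le3 a; lia.
Qed.

Lemma K23_leg_nat x y a b c : is_K23 x y a b c ->
  [\/ [/\ degree a = 2, codeg2 a a = 12 & nbr_deg 1 a = 0],
      [/\ degree a = 3, codeg2 a a = 17 & nbr_deg 1 a = 1] |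
      [/\ degree a = 3, 18 <= codeg2 a a <= 19 & nbr_deg 1 a = 0]]%N.
Proof.
move=> K; have kE := codeg2_nbr_deg deg_gt0 deg_le3 a.
have dE := degree_nbr_deg deg_gt0 deg_le3 a.
rewrite (K23_squares_leg bicG K) in kE; have n3 := K23_nbr_deg3 K.
case: (K23_leg_degree K) => d; rewrite d in dE kE *.
  by constructor 1; split; lia.
have [n1|n1] := eqVneq (nbr_deg 1%N a) 1%N.
  by constructor 2; split; lia.
by constructor 3; split; lia.
Qed.

Lemma K23_leg (F : realFieldType) x y a b c : is_K23 x y a b c ->
  let cost := leg_cost (28 / 100 : F) (143 / 1000) a in
  (degree a = 2%N -> short_leg (degree a)%:R (codeg2 a a)%:R cost) /\
  (degree a = 3%N -> long_leg (degree a)%:R (codeg2 a a)%:R cost).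
Proof.
move=> K; rewrite /leg_cost (sum_demand deg_gt0 deg_le3) mulr0 addr0.
case: (K23_leg_nat K) => -[-> k ->]; split=> // _.
- by split; rewrite ?k //; ring.
- by split=> //; left; split; rewrite ?k //; ring.
- by split=> //; right; split; rewrite ?ler_nat //; ring.
Qed.

Lemma charge_leg al ka x y a b c : is_K23 x y a b c ->
  charge al ka 0 a = leg_cost al ka a.
Proof.
move=> K; rewrite /charge /leg_cost; suff -> : demand ka 0 (degree a) = 0.
  by rewrite mulr0 subr0.
by case: (K23_leg_degree K) => ->.
Qed.

Lemma charge_hub al ka x y a b c : is_K23 x y a b c ->
  charge al ka 0 x = al.
Proof.
move=> K; rewrite /charge (K23_sum_legs _ K) (K23_degree K).
have [Kb Kc _ _ _] := is_K23_perms K.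
have D v : degree v = 2%N \/ degree v = 3%N -> demand ka 0 (degree v) = 0.
  by case=> ->.
rewrite (D a (K23_leg_degree K)) (D b (K23_leg_degree Kb)).
rewrite (D c (K23_leg_degree Kc)) /demand /= mulr0; ring.
Qed.

Lemma sum_core (V : zmodType) (f : G -> V) x y a b c : is_K23 x y a b c ->
  \sum_v f v = f x + f y + (f a + f b + f c)
    + \sum_(v | v \notin [:: x; y; a; b; c]) f v.
Proof.
move=> K; rewrite (bigID (mem [:: x; y; a; b; c])) /=.
by rewrite -(big_uniq _ (K23_uniq K)) /= !big_cons big_nil addr0 !addrA.
Qed.

Lemma K23_sum_outside al ka x y a b c : is_K23 x y a b c ->
  \sum_(v | v \notin [:: x; y; a; b; c]) (1 + charge al ka 0 v) =
  #|G|%:R - (5 + (leg_cost al ka a + leg_cost al ka b + leg_cost al ka c)).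
Proof.
move=> K; have [Kb Kc _ _ _] := is_K23_perms K.
have := sum_core (fun v => 1 + charge al ka 0 v) K.
rewrite big_split /= sumr_const sum_charge ?bicyclic_edges //.
rewrite (charge_hub _ _ K) (charge_hub _ _ (is_K23_swap K)).
rewrite (charge_leg _ _ K) (charge_leg _ _ Kb) (charge_leg _ _ Kc).
by rewrite cardT -cardE => E; lra.
Qed.

Lemma K23_outside x y a b c : is_K23 x y a b c ->
  let cost := leg_cost (28 / 100 : rat) (143 / 1000) in
  absadj x x + absadj y y + (absadj a a + absadj b b + absadj c c)
  + ratr (#|G|%:R - (5 + (cost a + cost b + cost c))) <= energy G.
Proof.
move=> K; cbv zeta; rewrite -(K23_sum_outside _ _ K) energy_absadj.
have D : forall v, v \notin [:: x; y; a; b; c] ->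
    charge_bound (28 / 100) (143 / 1000) 0 (0 : rat) (nbr_deg 1%N v)
      (nbr_deg 2%N v) (nbr_deg 3%N v) (squares v).
  move=> v vN; rewrite (K23_squares_outside bicG K vN).
  apply: charge_outside; have := degree_nbr_deg deg_gt0 deg_le3 v.
  by have := deg_gt0 v; have := deg_le3 v; lia.
move: (28 / 100) (143 / 1000) D => al ka D.
rewrite (sum_core _ K) lerD2l rmorph_sum; apply: ler_sum => v /D.
by move/(absadj_charge deg_gt0 deg_le3); rewrite mul0r subr0.
Qed.

Lemma absadj_hub_ge (t : rat) x y a b c : is_K23 x y a b c -> 0 < t ->
  ratr (hub_bound t (degree a)%:R (degree b)%:R (degree c)%:R) <= absadj x x.
Proof.
move=> K t0; have := absadj_ge x t0; rewrite (K23_degree K) /hub_bound.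
suff -> : codeg2 x x = (12 + degree a + degree b + degree c)%N.
  by rewrite !natrD.
have := codeg2_diag x; rewrite (K23_squares_hub bicG K) (K23_degree K).
have := K23_sum_legs (@degree G) K => ->.
rewrite /GRing.add /=; lia.
Qed.

Lemma qform_leg_ge (t r s z : rat) x y a b c : is_K23 x y a b c -> 0 < t ->
  ratr (leg_bound t r s z (degree a)%:R (degree b)%:R (degree c)%:R
    (codeg2 a a)%:R (codeg2 b b)%:R (codeg2 c c)%:R)
  <= qform_abs [:: (r, a); (s, b); (z, c)].
Proof.
move=> K t0; have := qform_abs_ge [:: (r, a); (s, b); (z, c)] t0.
have [_ _ Kac Kbc _] := is_K23_perms K.
rewrite /qform_rat !qform3 /leg_bound !codeg_diag.
rewrite (codegC b a) (codegC c a) (codegC c b) (codeg2C b a) (codeg2C c a).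
rewrite (codeg2C c b) (K23_codeg_leg bicG K) (K23_codeg_leg bicG Kac).
rewrite (K23_codeg_leg bicG Kbc) (K23_codeg2_leg bicG K).
rewrite (K23_codeg2_leg bicG Kac) (K23_codeg2_leg bicG Kbc).
rewrite !(natrD, natrM); apply: le_trans; rewrite ler_rat le_eqVlt.
by apply/orP; left; apply/eqP; congr (_ * _ - _ * _); ring.
Qed.

End K23Energy.

Section Combine.

Variable G : sgraph.
Implicit Types u v w x y a b c : G.

Lemma absadj_basis2 u v :
  absadj u u + absadj v v =
  qform_abs [:: (1, u); (1, v)] / 2 + qform_abs [:: (1, u); (- 1, v)] / 2.
Proof. by rewrite /qform_abs !qform2 !(rmorphN, rmorph1); field. Qed.

Lemma absadj_basis3 u v w :
  absadj u u + absadj v v + absadj w w =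
  qform_abs [:: (1, u); (1, v); (1, w)] / 3
  + qform_abs [:: (1, u); (- 1, v); (0, w)] / 2
  + qform_abs [:: (1, u); (1, v); (- 2, w)] / 6.
Proof.
by rewrite /qform_abs !qform3 !(rmorphN, rmorph0, rmorph1, rmorph_nat); field.
Qed.

Lemma absadj_basis433 u v w :
  absadj u u + absadj v v + absadj w w =
  qform_abs [:: (4, u); (3, v); (3, w)] / 34
  + qform_abs [:: (3, u); (- 2, v); (- 2, w)] / 17
  + qform_abs [:: (0, u); (1, v); (- 1, w)] / 2.
Proof.
by rewrite /qform_abs !qform3 !(rmorphN, rmorph0, rmorph1, rmorph_nat); field.
Qed.

Lemma ratr_core_le (h l1 l2 l3 : rat) (X Y Q1 Q2 Q3 : algC) (p q r : nat) :
  ratr h <= X -> ratr h <= Y -> ratr l1 <= Q1 -> ratr l2 <= Q2 ->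
  ratr l3 <= Q3 ->
  ratr (2 * h + l1 / p%:R + l2 / q%:R + l3 / r%:R)
  <= X + Y + (Q1 / p%:R + Q2 / q%:R + Q3 / r%:R).
Proof.
move=> hX hY h1 h2 h3.
rewrite !rmorphD !rmorphM !fmorphV /= !ratr_nat mulrDl mul1r -!addrA.
by rewrite !(lerD, ler_wpM2r, invr_ge0, ler0n).
Qed.

End Combine.

Section K23Cases.

Variable G : sgraph.
Hypothesis bicG : bicyclic G.
Hypothesis deg_le3 : forall v : G, (degree v <= 3)%N.
Variables x y a b c : G.
Hypothesis K : is_K23 x y a b c.

Let Kb : is_K23 x y b a c.
Proof. by have [] := is_K23_perms K. Qed.

Let Kc : is_K23 x y c a b.
Proof. by have [] := is_K23_perms K. Qed.

Let lt_rat (n s r : rat) (E C : algC) :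
  s < r -> ratr r <= C -> C + ratr (n - s) <= E -> ratr n < E.
Proof.
move=> sr rC CE; apply: lt_le_trans CE; rewrite -ltrBlDr -rmorphB.
by apply: lt_le_trans rC; rewrite ltr_rat opprB addrC subrK.
Qed.

Lemma K23_energy_one :
  degree a = 3%N -> degree b = 2%N -> degree c = 2%N -> #|G|%:R < energy G.
Proof.
move=> da db dc; rewrite -ratr_nat.
have [_ /(_ da) A] := K23_leg bicG deg_le3 rat K.
have [/(_ db) B _] := K23_leg bicG deg_le3 rat Kb.
have [/(_ dc) C _] := K23_leg bicG deg_le3 rat Kc.
apply: lt_rat (one_long_leg A B C) _ (K23_outside bicG deg_le3 K).
have t1 : 0 < 5 / 2 :> rat by lra.
have t2 : 0 < 51 / 20 :> rat by lra.
have t3 : 0 < 11 / 7 :> rat by lra.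
have hx := absadj_hub_ge bicG K t1.
have hy := absadj_hub_ge bicG (is_K23_swap K) t1.
have h1 := qform_leg_ge bicG 4 3 3 K t2.
have h2 := qform_leg_ge bicG 3 (- 2) (- 2) K t3.
have h3 := qform_leg_ge bicG 0 1 (- 1) K ltr01.
by rewrite absadj_basis433; exact: ratr_core_le 34 17 2 hx hy h1 h2 h3.
Qed.

Lemma K23_energy_many :
  degree a = 3%N -> degree b = 3%N -> #|G|%:R < energy G.
Proof.
move=> da db; rewrite -ratr_nat.
have [_ /(_ da) A] := K23_leg bicG deg_le3 rat K.
have [_ /(_ db) B] := K23_leg bicG deg_le3 rat Kb.
have [C2 C3] := K23_leg bicG deg_le3 rat Kc.
have C : long_leg (degree c)%:R (codeg2 c c)%:R
      (leg_cost (28 / 100 : rat) (143 / 1000) c) \/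
    short_leg (degree c)%:R (codeg2 c c)%:R
      (leg_cost (28 / 100 : rat) (143 / 1000) c).
  by case: (K23_leg_degree bicG deg_le3 Kc) => d;
    [right; apply: C2 | left; apply: C3].
apply: lt_rat (many_long_legs A B C) _ (K23_outside bicG deg_le3 K).
have t1 : 0 < 13 / 5 :> rat by lra.
have t2 : 0 < 7 / 4 :> rat by lra.
have hx := absadj_hub_ge bicG K t1.
have hy := absadj_hub_ge bicG (is_K23_swap K) t1.
have h1 := qform_leg_ge bicG 1 1 1 K t1.
have h2 := qform_leg_ge bicG 1 (- 1) 0 K t2.
have h3 := qform_leg_ge bicG 1 1 (- 2) K t2.
by rewrite absadj_basis3; exact: ratr_core_le 3 2 6 hx hy h1 h2 h3.
Qed.

Lemma K23_short_nbrs v : degree a = 2%N -> adj a v -> v \in [:: x; y].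
Proof.
move=> da av; apply: contraT => vxy; suff : (3 <= degree a)%N by rewrite da.
have [xy _ Nx Ny] := K.
have U : uniq [:: v; x; y] by rewrite cons_uniq vxy /= inE xy.
rewrite -[3%N]/(size [:: v; x; y]) -(card_uniqP U).
apply/subset_leq_card/subsetP => w; rewrite !inE => /or3P[] /eqP -> //;
  by rewrite adj_sym ?Nx ?Ny inE eqxx.
Qed.

End K23Cases.

Lemma ratr_basis_le (l1 l2 l3 l4 l5 : rat) (Q1 Q2 Q3 Q4 Q5 : algC) :
  Q1 <= ratr l1 -> Q2 <= ratr l2 -> Q3 <= ratr l3 -> Q4 <= ratr l4 ->
  Q5 <= ratr l5 ->
  Q1 / 2 + Q2 / 2 + (Q3 / 3 + Q4 / 2 + Q5 / 6)
  <= ratr (l1 / 2 + l2 / 2 + (l3 / 3 + l4 / 2 + l5 / 6)).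
Proof.
move=> h1 h2 h3 h4 h5; rewrite !rmorphD !rmorphM !fmorphV /= !ratr_nat.
by rewrite !(lerD, ler_wpM2r, invr_ge0, ler0n).
Qed.

Lemma short_legs_lt (F : realFieldType) :
  (1 / 2 / (5 / 2) * (3 * (1 + 1) ^+ 2) + 5 / 2 / 2 * (1 ^+ 2 + 1 ^+ 2)) / 2
  + (1 / 2 / (1 / 50) * (3 * (1 + - 1) ^+ 2)
     + 1 / 50 / 2 * (1 ^+ 2 + (- 1) ^+ 2)) / 2
  + ((1 / 2 / (5 / 2) * (2 * (1 + 1 + 1) ^+ 2)
      + 5 / 2 / 2 * (1 ^+ 2 + 1 ^+ 2 + 1 ^+ 2)) / 3
     + (1 / 2 / (1 / 50) * (2 * (1 + - 1 + 0) ^+ 2)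
        + 1 / 50 / 2 * (1 ^+ 2 + (- 1) ^+ 2 + 0 ^+ 2)) / 2
     + (1 / 2 / (1 / 50) * (2 * (1 + 1 + - 2) ^+ 2)
        + 1 / 50 / 2 * (1 ^+ 2 + 1 ^+ 2 + (- 2) ^+ 2)) / 6) < 5 :> F.
Proof. lra. Qed.

Section K23Graph.

Variable G : sgraph.
Hypothesis bicG : bicyclic G.
Variables x y a b c : G.
Hypothesis K : is_K23 x y a b c.
Hypothesis short : forall u, u \in [:: a; b; c] -> degree u = 2%N.

Let Kb : is_K23 x y b a c.
Proof. by have [] := is_K23_perms K. Qed.

Let Kc : is_K23 x y c a b.
Proof. by have [] := is_K23_perms K. Qed.

Let spanning v : v \in [:: x; y; a; b; c].
Proof.
have [_ _ Nx Ny] := K; have [[_ conn] _] := bicG.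
have cl : closed (@adj G) (mem [:: x; y; a; b; c]).
  apply: intro_closed => [|u w uw]; first exact/sym_connect_sym/adj_sym.
  have hubs : w \in [:: x; y] -> w \in [:: x; y; a; b; c].
    by rewrite !inE => /orP[] ->; rewrite ?orbT.
  have legs : w \in [:: a; b; c] -> w \in [:: x; y; a; b; c].
    by rewrite !inE => /or3P[] ->; rewrite ?orbT.
  change (u \in [:: x; y; a; b; c] -> w \in [:: x; y; a; b; c]).
  have uE : u \in [:: x; y; a; b; c] =
      [|| u == x, u == y, u == a, u == b | u == c] by rewrite !inE.
  rewrite uE => /or4P[/eqP ux|/eqP uy|/eqP ua|/orP[/eqP ub|/eqP uc]].
  - by apply: legs; rewrite -Nx -ux.
  - by apply: legs; rewrite -Ny -uy.
  - by apply/hubs/(K23_short_nbrs K); rewrite -?ua // short ?inE ?ua ?eqxx.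
  - by apply/hubs/(K23_short_nbrs Kb);
      rewrite -?ub // short ?inE ?ub ?eqxx ?orbT.
  - by apply/hubs/(K23_short_nbrs Kc);
      rewrite -?uc // short ?inE ?uc ?eqxx ?orbT.
by rewrite -(closed_connect cl (conn x v)) inE eqxx.
Qed.

Let cardG : #|G| = 5%N.
Proof.
rewrite -[5%N]/(size [:: x; y; a; b; c]) -(card_uniqP (K23_uniq K)).
by apply: eq_card => v; rewrite spanning.
Qed.

Let hubs_le (r s t : rat) : 0 < t ->
  qform_abs [:: (r, x); (s, y)] <=
  ratr (1 / 2 / t * (3 * (r + s) ^+ 2) + t / 2 * (r ^+ 2 + s ^+ 2)).
Proof.
move=> /(qform_abs_le [:: (r, x); (s, y)]) le; apply: le_trans le _.
rewrite ler_rat le_eqVlt; apply/orP; left; apply/eqP.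
rewrite /qform_rat !qform2 !codeg_diag (codegC y) !eqxx !(K23_eqF K).
rewrite (K23_codeg_hub K) (K23_degree K) (K23_degree (is_K23_swap K)).
by rewrite /nat_of_bool !mulr0n !mulr1n; congr (_ * _ + _ * _); ring.
Qed.

Let legs_le (r s z t : rat) : 0 < t ->
  qform_abs [:: (r, a); (s, b); (z, c)] <=
  ratr (1 / 2 / t * (2 * (r + s + z) ^+ 2)
        + t / 2 * (r ^+ 2 + s ^+ 2 + z ^+ 2)).
Proof.
move=> /(qform_abs_le [:: (r, a); (s, b); (z, c)]) le; apply: le_trans le _.
rewrite ler_rat le_eqVlt; apply/orP; left; apply/eqP.
have [_ _ Kac Kbc _] := is_K23_perms K.
rewrite /qform_rat !qform3 !codeg_diag (codegC b a) (codegC c a) (codegC c b).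
rewrite !eqxx !(K23_eqF K) (K23_codeg_leg bicG K) (K23_codeg_leg bicG Kac).
rewrite (K23_codeg_leg bicG Kbc) !short ?inE ?eqxx ?orbT //.
by rewrite /nat_of_bool !mulr0n !mulr1n; congr (_ * _ + _ * _); ring.
Qed.

Lemma K23_energy_short : energy G < #|G|%:R.
Proof.
rewrite energy_absadj (sum_core _ K) [X in _ + X]big_pred0; last first.
  by move=> v; rewrite spanning.
rewrite addr0 absadj_basis2 absadj_basis3 cardG.
have t1 : 0 < 5 / 2 :> rat by lra.
have t2 : 0 < 1 / 50 :> rat by lra.
have h1 := hubs_le 1 1 t1; have h2 := hubs_le 1 (- 1) t2.
have h3 := legs_le 1 1 1 t1; have h4 := legs_le 1 (- 1) 0 t2.
have h5 := legs_le 1 1 (- 2) t2.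
have le5 := ratr_basis_le h1 h2 h3 h4 h5.
apply: le_lt_trans le5 _; rewrite -[X in _ < X](ratr_nat _ 5%N) ltr_rat.
exact: short_legs_lt.
Qed.

End K23Graph.
Lemma exists_K23 (G : sgraph) (v w : G) :
  (forall u : G, (degree u <= 3)%N) -> v != w -> (2 < codeg v w)%N ->
  exists a b c, is_K23 v w a b c.
Proof.
move=> deg_le3 vw c3.
have sub (u1 u2 : G) :
    [set u | adj u1 u && adj u2 u] \subset [set u | adj u1 u].
  by apply/subsetP => u; rewrite !inE => /andP[].
have Nv : [set u | adj v u && adj w u] = [set u | adj v u].
  by apply/eqP; rewrite eqEcard sub (leq_trans (deg_le3 v)).
have Nw : [set u | adj v u && adj w u] = [set u | adj w u].
  apply/eqP; rewrite eqEcard (leq_trans (deg_le3 w)) // andbT.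
  by apply/subsetP => u; rewrite !inE => /andP[].
have : size (enum [set u | adj v u]) = 3%N.
  by apply/eqP; rewrite -cardE eqn_leq deg_le3 -Nv.
case E : (enum _) => [|a [|b [|c [|? ?]]]] // _; exists a, b, c.
have mE u : (u \in [:: a; b; c]) = adj v u by rewrite -E mem_enum inE.
split=> // [|u]; first by rewrite -E enum_uniq.
by rewrite mE; have /setP/(_ u) := Nw; rewrite Nv !inE.
Qed.

Theorem theorem2p7 :
  ~ exists G : sgraph,
      [/\ bicyclic G, (max_degree G <= 3)%N & energy G = #|G|%:R].
Proof.
case=> G [bicG deg3 energyE].
have deg_le3 (v : G) : (degree v <= 3)%N.
  by apply: leq_trans deg3; apply: leq_bigmax.
suff : #|G|%:R < energy G \/ energy G < #|G|%:R by rewrite energyE ltxx; case.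
have [[v w]|] := pickP (fun s : G * G => (s.1 != s.2) && (2 < codeg s.1 s.2)%N).
  case/andP=> /= vw c3; have [a [b [c K]]] := exists_K23 deg_le3 vw c3.
  have [Kb Kc Kac Kbc _] := is_K23_perms K.
  case: (K23_leg_degree bicG deg_le3 K) (K23_leg_degree bicG deg_le3 Kb)
    (K23_leg_degree bicG deg_le3 Kc) => da [] db [] dc.
  - right; apply: (K23_energy_short bicG K) => u.
    by rewrite !inE => /or3P[] /eqP ->.
  - by left; apply: (K23_energy_one bicG deg_le3 Kc).
  - by left; apply: (K23_energy_one bicG deg_le3 Kb).
  - by left; apply: (K23_energy_many bicG deg_le3 Kbc).
  - by left; apply: (K23_energy_one bicG deg_le3 K).
  - by left; apply: (K23_energy_many bicG deg_le3 Kac).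
  - by left; apply: (K23_energy_many bicG deg_le3 K).
  - by left; apply: (K23_energy_many bicG deg_le3 K).
move=> no; left; apply: (energy_gt_sparse bicG deg_le3) => v w vw.
by have := no (v, w); rewrite /= vw /= ltnNge => /negbFE.
Qed.
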